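(* Let $L>3$ be an integer and $c_L=L/(L-\lceil L/3\rceil+1)$. If directed (unweighted) $L$-cycle can be solved in $O(M^{c_L-\epsilon})$ time for some $\epsilon>0$ on graphs with $M$ edges, then Max-3-SAT on $n$ variables can be solved in $\tilde{O}(2^{(1-\epsilon')n})$ time for some $\epsilon'>0$.
   Context: Directed $L$-cycle: decide whether a directed graph contains a simple directed cycle on exactly $L$ vertices. Max-3-SAT: given a 3-CNF formula on $n$ variables and $m$ clauses, find a Boolean assignment satisfying the maximum number of clauses. $\tilde{O}$ hides factors polynomial in $n$ and $m$. *)

(* Defs.v *)
From mathcomp Require Import all_boot all_order all_algebra.
From mathcomp Require Import reals exp.

Set Implicit Arguments.
Unset Strict Implicit.
Unset Printing Implicit Defensive.

Import Order.TTheory GRing.Theory Num.Theory.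

(* Word RAM: unit-cost instructions on registers and a randomly addressable
   memory, all holding [w]-bit words.  A step that would put a value of more than
   [w] bits into a register is an error ([step] returns [None]) rather than
   wrapping around, so a run that is correct for one word length is unchanged for
   every larger one.  Arithmetic modulo a power of two stays available through
   [OMod] or [OAnd], at the price of doubling the word length. *)

Inductive binop :=
  OAdd | OSub | OMul | ODiv | OMod | OAnd | OOr | OXor | OShl | OShr.

Definition binop_sem (o : binop) : nat -> nat -> nat :=
  match o with
  | OAdd => addn
  | OSub => subn
  | OMul => muln
  | ODiv => divn
  | OMod => modn
  | OAnd => Nat.land
  | OOr => Nat.lor
  | OXor => Nat.lxor
  | OShl => fun x y => x * 2 ^ y
  | OShr => fun x y => x %/ 2 ^ y
  end.

Inductive instr :=
  | IConst (r k : nat)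
  | IOp (o : binop) (r a b : nat)
  | ILoad (r a : nat)
  | IStore (a b : nat)
  | IJz (a l : nat).

Definition program := seq instr.

Record config := Config { pc : nat; regs : nat -> nat; memory : nat -> nat }.

Definition upd (f : nat -> nat) (a v : nat) : nat -> nat :=
  fun x => if x == a then v else f x.

Definition set_reg (w : nat) (c : config) (r v : nat) : option config :=
  if v < 2 ^ w then Some (Config (pc c).+1 (upd (regs c) r v) (memory c)) else None.

Definition exec_instr (w : nat) (i : instr) (c : config) : option config :=
  match i with
  | IConst r k => set_reg w c r k
  | IOp o r a b => set_reg w c r (binop_sem o (regs c a) (regs c b))
  | ILoad r a => set_reg w c r (memory c (regs c a))
  | IStore a b =>
      Some (Config (pc c).+1 (regs c) (upd (memory c) (regs c a) (regs c b)))
  | IJz a l =>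
      Some (Config (if regs c a == 0 then l else (pc c).+1) (regs c) (memory c))
  end.

Definition step (w : nat) (p : program) (c : config) : option config :=
  obind (fun i => exec_instr w i c) (onth p (pc c)).

(* A program halts by moving its program counter past its last instruction. *)
Definition halts_in (w : nat) (p : program) (c : config) (k : nat)
    (c' : config) : Prop :=
  iter k (obind (step w p)) (Some c) = Some c' /\ size p <= pc c'.

(* The input occupies the first memory cells; all else is initially zero. *)
Definition init (s : seq nat) : config := Config 0 (fun=> 0) (nth 0 s).

Record problem := Problem {
  inst : Type;
  inst_size : inst -> nat;
  input : inst -> seq nat;
  answer : inst -> (nat -> nat) -> Prop }. (* on the final memory *)

(* [p] solves [Q], taking at most [t x] steps on [x], with words of
   O(log (inst_size x + t x)) bits.  Letting the word length grow with the
   logarithm of the running time is what allows an exponential-time algorithm to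
   address its memory; for polynomial [t] it is the usual O(log (inst_size x)). *)
Definition solves (Q : problem) (p : program) (t : inst Q -> nat) : Prop :=
  exists kappa : nat, forall x : inst Q, exists (k : nat) (c : config),
    [/\ k <= t x,
        halts_in (kappa * (trunc_log 2 (inst_size x + t x)).+1) p
          (init (input x)) k c
      & answer x (memory c)].

Record digraph := Digraph {
  nverts : nat;
  edges : seq ('I_nverts * 'I_nverts);
  edges_uniq : uniq edges;
  edges_loopless : all (fun e => e.1 != e.2) edges }.

Definition nedges (G : digraph) : nat := size (edges G).

Definition digraph_input (G : digraph) : seq nat :=
  [:: nverts G, nedges G & flatten [seq [:: val e.1; val e.2] | e <- edges G]].

Definition has_cycle (L : nat) (G : digraph) : bool :=
  [exists c : L.-tuple 'I_(nverts G),
     uniq c && cycle (fun u v => (u, v) \in edges G) c].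

Definition directed_cycle (L : nat) : problem := {|
  inst := digraph;
  inst_size := fun G => nverts G + nedges G;
  input := digraph_input;
  answer := fun G out => out 0 = has_cycle L G |}.

(* 3-CNF formulas.  The literal [(v, b)] is true when [v] has value [b].  The
   three literals of a clause may coincide, which covers shorter clauses. *)

Record cnf3 := Cnf3 {
  nvars : nat;
  clauses : seq (3.-tuple ('I_nvars * bool)) }.

Definition nclauses (F : cnf3) : nat := size (clauses F).

Definition assignment (F : cnf3) := {ffun 'I_(nvars F) -> bool}.

Definition num_sat (F : cnf3) (a : assignment F) : nat :=
  count (fun cl : 3.-tuple ('I_(nvars F) * bool) => has (fun l => a l.1 == l.2) cl)
        (clauses F).

Definition literal_code (n : nat) (l : 'I_n * bool) : nat := (val l.1).*2 + l.2.

Definition cnf3_input (F : cnf3) : seq nat :=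
  [:: nvars F, nclauses F
    & flatten [seq [seq literal_code l | l <- tval cl] | cl <- clauses F]].

Definition max3sat : problem := {|
  inst := cnf3;
  inst_size := fun F => nvars F + nclauses F;
  input := cnf3_input;
  answer := fun F out => exists a : assignment F,
    (forall i : 'I_(nvars F), out i = a i) /\
    (forall b : assignment F, num_sat b <= num_sat a) |}.

Local Open Scope ring_scope.

Definition c_exp (R : realType) (L : nat) : R :=
  L%:R / (L%:R - (Num.ceil (L%:R / 3%:R : R))%:~R + 1).

(* O(M^e) on graphs with M edges is asymptotic in M, uniformly in the number of
   vertices; below [M0] edges the program must be correct but may take any time. *)
Definition directed_cycle_time (R : realType) (L : nat) (e : R) : Prop :=
  exists (p : program) (t : inst (directed_cycle L) -> nat),
    solves p t /\
    exists (C : R) (M0 : nat), forall G : digraph,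
      (M0 <= nedges G)%N -> (t G)%:R <= C * (nedges G)%:R `^ e.

(* 2^(d n) up to a factor polynomial in the numbers of variables and clauses;
   [+ 1] keeps that factor nonzero on the empty formula. *)
Definition max3sat_time (R : realType) (d : R) : Prop :=
  exists (p : program) (t : inst max3sat -> nat),
    solves p t /\
    exists (C : R) (k : nat), forall F : cnf3,
      (t F)%:R <=
        C * (nvars F + nclauses F + 1)%:R ^+ k * 2 `^ (d * (nvars F)%:R).

(* Main.v *)
(* Fix the window width g + 1 = L - ceil(L/3) + 1 and split the n variables cyclically
   into L groups of about n / L.  Of the three cyclic gaps between the groups of the
   variables of a clause one is at least ceil(L/3), so every clause lies within g + 1
   consecutive groups and can be charged to one of the L windows.  Guess, for every
   window, a lower bound on the number of its clauses that are satisfied: (m + 1)^L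
   guesses.  For one guess consider the L-layered graph whose edges out of layer e are
   the assignments to window e that meet the bound, the edge joining its first g groups
   to its last g groups.  Its L-cycles are the assignments that meet all the bounds, and
   it has M = O(2^(n (g + 1) / L)) = O(2^(n / c_L)) edges, so that M^(c_L - eps) is
   2^((1 - eps / c_L) n).  The best feasible guess gives the optimum, and n further
   queries with prescribed values of the first variables produce an assignment.

   The reduction is a program of a while-language that has a cost semantics and compiles
   to the word RAM; it runs the given cycle program through an interpreter. *)

Require Import Defs.
From Stdlib Require Import PeanoNat.
From mathcomp Require Import all_boot all_order all_algebra.
From mathcomp Require Import reals exp.
From mathcomp Require Import zify ring lra.

Set Implicit Arguments.
Unset Strict Implicit.
Unset Printing Implicit Defensive.

(** * A while-language with costs *)

(** An overflowing RAM step is an error, so correctness includes a bound on every value written.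
    This is affordable because words may grow with the logarithm of the running time: most of what
    the reduction stores is bounded by its time, and constant factors in the word length pay for the
    rest, above all for the single word that holds a whole assignment. The cycle program is a black
    box: it may count on shorter words, it leaves its memory dirty, and its time bound says nothing
    below [M0] edges. Hence the numbered memory cells of the interpreter, and a star of extra edges,
    lying on no cycle, in each query graph. Thresholds are lower bounds so that a feasible guess
    certifies its sum, while the guess read off from an optimal assignment is tight; both rest on
    charging each clause to one window only, which makes the weights add up to the number of
    satisfied clauses. For large eps the exponent c_L - eps drops below 1, and building the graph
    would cost more than the query; the gain is therefore capped at c_L - 1. *)

Inductive expr :=
  | EV of nat
  | EC of nat
  | EO of binop & expr & expr
  | EL of expr.

Inductive cmd :=
  | Skip
  | Asg of nat & expr
  | Sto of expr & expr
  | Seq of cmd & cmd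
  | Ite of expr & cmd & cmd
  | Whl of expr & cmd.

Record state := State { vars : nat -> nat; cells : nat -> nat }.

Fixpoint eval (e : expr) (s : state) : nat :=
  match e with
  | EV v => vars s v
  | EC k => k
  | EO o a b => binop_sem o (eval a s) (eval b s)
  | EL a => cells s (eval a s)
  end.

Definition set_var (s : state) (v x : nat) := State (upd (vars s) v x) (cells s).
Definition set_mem (s : state) (a x : nat) := State (vars s) (upd (cells s) a x).

Fixpoint esz (e : expr) : nat :=
  match e with
  | EV _ | EC _ => 1
  | EO _ a b => esz a + esz b + 1
  | EL a => esz a + 1
  end.

(* The constants count the jump instructions of the compiled code [ccmd]. *)
Inductive exec (h : nat) : cmd -> state -> nat -> state -> Prop :=
  | ExSkip s : exec h Skip s 0 s
  | ExAsg v e s : eval e s < 2 ^ h ->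
      exec h (Asg v e) s (esz e + 1) (set_var s v (eval e s))
  | ExSto a b s : eval b s < 2 ^ h ->
      exec h (Sto a b) s (esz a + esz b + 1) (set_mem s (eval a s) (eval b s))
  | ExSeq c1 c2 s1 s2 s3 n1 n2 :
      exec h c1 s1 n1 s2 -> exec h c2 s2 n2 s3 ->
      exec h (Seq c1 c2) s1 (n1 + n2) s3
  | ExThen e c1 c2 s s' n : eval e s != 0 -> exec h c1 s n s' ->
      exec h (Ite e c1 c2) s (esz e + 1 + (n + 2)) s'
  | ExElse e c1 c2 s s' n : eval e s = 0 -> exec h c2 s n s' ->
      exec h (Ite e c1 c2) s (esz e + 1 + n) s'
  | ExDone e c s : eval e s = 0 -> exec h (Whl e c) s (esz e + 1) s
  | ExIter e c s1 s2 s3 n1 n2 : eval e s1 != 0 -> exec h c s1 n1 s2 ->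
      exec h (Whl e c) s2 n2 s3 ->
      exec h (Whl e c) s1 (esz e + 1 + (n1 + 2) + n2) s3.

(** * Compilation to the word RAM *)

(* Variables live in the even registers, temporaries in the odd ones. *)
Definition tmp (t : nat) := t.*2.+1.

(** The RAM has no move between registers; [OOr] of a register with itself serves as one. *)
Fixpoint cexpr (t : nat) (e : expr) : seq instr :=
  match e with
  | EV v => [:: IOp OOr (tmp t) v.*2 v.*2]
  | EC k => [:: IConst (tmp t) k]
  | EO o a b => cexpr t a ++ cexpr t.+1 b ++ [:: IOp o (tmp t) (tmp t) (tmp t.+1)]
  | EL a => cexpr t a ++ [:: ILoad (tmp t) (tmp t)]
  end.

Fixpoint csz (c : cmd) : nat :=
  match c with
  | Skip => 0
  | Asg _ e => esz e + 1
  | Sto a b => esz a + esz b + 1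
  | Seq c1 c2 => csz c1 + csz c2
  | Ite e c1 c2 => esz e + 1 + (csz c1 + 2) + csz c2
  | Whl e c => esz e + 1 + (csz c + 2)
  end.

(** Jump targets are absolute, so the code depends on its offset [o]. An unconditional jump is a
    jump on a temporary that has just been set to 0. *)
Fixpoint ccmd (o : nat) (c : cmd) : seq instr :=
  match c with
  | Skip => [::]
  | Asg v e => cexpr 0 e ++ [:: IOp OOr v.*2 (tmp 0) (tmp 0)]
  | Sto a b => cexpr 0 a ++ cexpr 1 b ++ [:: IStore (tmp 0) (tmp 1)]
  | Seq c1 c2 => ccmd o c1 ++ ccmd (o + csz c1) c2
  | Ite e c1 c2 =>
      let o1 := o + esz e + 1 in
      let o2 := o1 + csz c1 + 2 in
      cexpr 0 e ++ [:: IJz (tmp 0) o2] ++ ccmd o1 c1 ++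
      [:: IConst (tmp 0) 0; IJz (tmp 0) (o2 + csz c2)] ++ ccmd o2 c2
  | Whl e c =>
      let o1 := o + esz e + 1 in
      cexpr 0 e ++ [:: IJz (tmp 0) (o1 + csz c + 2)] ++ ccmd o1 c ++
      [:: IConst (tmp 0) 0; IJz (tmp 0) o]
  end.

Lemma size_cexpr t e : size (cexpr t e) = esz e.
Proof.
elim: e t => [v|k|o a IHa b IHb|a IHa] t //=; rewrite !size_cat ?IHa ?IHb /=; lia.
Qed.

Lemma size_ccmd o c : size (ccmd o c) = csz c.
Proof.
elim: c o => [|v e|a b|c1 IH1 c2 IH2|e c1 IH1 c2 IH2|e c IH] o //=;
  rewrite !(size_cat, size_cexpr) /= ?size_cat ?IH1 ?IH2 ?IH /= ?IH2; lia.
Qed.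

(** * Runs of compiled code *)

Definition placed (p : program) (o : nat) (code : seq instr) :=
  exists a b, p = a ++ code ++ b /\ size a = o.

Lemma placed_cat p o c1 c2 :
  placed p o (c1 ++ c2) -> placed p o c1 /\ placed p (o + size c1) c2.
Proof.
move=> [a [b [-> <-]]]; split.
  by exists a, (c2 ++ b); rewrite -catA.
by exists (a ++ c1), b; rewrite size_cat -!catA.
Qed.

Lemma placed_onth p o i c : placed p o (i :: c) -> onth p o = Some i.
Proof.
move=> [a [b [-> <-]]].
by elim: a => [|x a IH].
Qed.

Definition reach (w : nat) (p : program) (n : nat) (c c' : config) :=
  iter n (obind (step w p)) (Some c) = Some c'.

Lemma reach_trans w p n1 n2 c1 c2 c3 :
  reach w p n1 c1 c2 -> reach w p n2 c2 c3 -> reach w p (n1 + n2) c1 c3.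
Proof. by rewrite /reach addnC iterD => -> ->. Qed.

Lemma reach1 w p c c' i : onth p (pc c) = Some i -> exec_instr w i c = Some c' ->
  reach w p 1 c c'.
Proof. by rewrite /reach /= /step => -> /= ->. Qed.

(** [exec] only asks that the final value of an expression fit; on the RAM each intermediate value
    passes through a register and has to fit as well. *)
Fixpoint safe (w : nat) (e : expr) (s : state) : bool :=
  (eval e s < 2 ^ w) &&
  match e with
  | EO _ a b => safe w a s && safe w b s
  | EL a => safe w a s
  | _ => true
  end.

Lemma safe_eval w e s : safe w e s -> eval e s < 2 ^ w.
Proof. by case: e => [v|k|o a b|a] /= /andP[]. Qed.

Definition represents (c : config) (s : state) :=
  (forall v, regs c v.*2 = vars s v) /\ memory c = cells s.

(** The last clause makes the temporaries a stack: the right operand is compiled at depth [t.+1] and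
    so leaves the value of the left one in [tmp t] alone. *)
Lemma reach_expr w p t e s c : placed p (pc c) (cexpr t e) -> safe w e s ->
  represents c s ->
  exists c', [/\ reach w p (esz e) c c', pc c' = pc c + esz e,
    regs c' (tmp t) = eval e s, represents c' s
    & forall r, r < tmp t -> regs c' r = regs c r].
Proof.
elim: e t c => [v|k|o a IHa b IHb|a IHa] t c.
- move=> /placed_onth pl /=; rewrite andbT => lt_w [rv rm].
  exists (Config (pc c).+1 (upd (regs c) (tmp t) (vars s v)) (memory c)); split.
  + by apply: (reach1 pl); rewrite /= /set_reg rv Nat.lor_diag lt_w.
  + by rewrite /= addn1.
  + by rewrite /= /upd eqxx.
  + by split => //= u; rewrite /upd /tmp; case: eqP => //; lia.
  + by move=> r lt_r; rewrite /= /upd; case: eqP => //; lia.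
- move=> /placed_onth pl /=; rewrite andbT => lt_w [rv rm].
  exists (Config (pc c).+1 (upd (regs c) (tmp t) k) (memory c)); split.
  + by apply: (reach1 pl); rewrite /= /set_reg lt_w.
  + by rewrite /= addn1.
  + by rewrite /= /upd eqxx.
  + by split => //= u; rewrite /upd /tmp; case: eqP => //; lia.
  + by move=> r lt_r; rewrite /= /upd; case: eqP => //; lia.
- move=> /= /placed_cat [pla]; rewrite size_cexpr => /placed_cat [plb].
  rewrite size_cexpr => /placed_onth plo /and3P[lt_w sa sb] rep.
  have [c1 [r1 p1 v1 rep1 k1]] := IHa _ _ pla sa rep.
  have [|c2 [r2 p2 v2 [rv2 rm2] k2]] := IHb t.+1 c1 _ sb rep1; first by rewrite p1.
  exists (Config (pc c2).+1 (upd (regs c2) (tmp t) (binop_sem o (eval a s) (eval b s)))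
    (memory c2)); split.
  + apply: reach_trans (reach_trans r1 r2) _.
    apply: (@reach1 _ _ _ _ (IOp o (tmp t) (tmp t) (tmp t.+1))).
      by rewrite p2 p1.
    by rewrite /= /set_reg v2 k2 ?v1 ?lt_w // /tmp; lia.
  + by rewrite /= p2 p1; lia.
  + by rewrite /= /upd eqxx.
  + by split => //= u; rewrite /upd /tmp; case: eqP => //; lia.
  + move=> r lt_r; rewrite /= /upd; case: eqP => [|_]; first lia.
    by rewrite k2 ?k1 //; move: lt_r; rewrite /tmp; lia.
- move=> /= /placed_cat [pla]; rewrite size_cexpr => /placed_onth plo /andP[lt_w sa] rep.
  have [c1 [r1 p1 v1 [rv1 rm1] k1]] := IHa _ _ pla sa rep.
  exists (Config (pc c1).+1 (upd (regs c1) (tmp t) (cells s (eval a s)))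
    (memory c1)); split.
  + apply: reach_trans r1 _; apply: (@reach1 _ _ _ _ (ILoad (tmp t) (tmp t))).
      by rewrite p1.
    by rewrite /= /set_reg v1 rm1 lt_w.
  + by rewrite /= p1; lia.
  + by rewrite /= /upd eqxx.
  + by split => //= u; rewrite /upd /tmp; case: eqP => //; lia.
  + by move=> r lt_r; rewrite /= /upd; case: eqP => [|_]; [lia|rewrite k1].
Qed.

(* The operations whose result is bounded by the product of the bounds of the
   operands. *)
Definition tame (o : binop) : bool :=
  match o with OAdd | OSub | OMul | ODiv | OMod | OShr => true | _ => false end.

Fixpoint pure (e : expr) : bool :=
  match e with
  | EV _ | EC _ => true
  | EO o a b => [&& tame o, pure a & pure b]
  | EL a => pure a
  end.

(** In an assignment the outermost operator is unrestricted, since [exec] itself demands that the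
    result fit. This admits left shifts and the bitwise instructions of the interpreted program. *)
Definition pure_args (e : expr) : bool :=
  match e with
  | EV _ | EC _ => true
  | EO _ a b => pure a && pure b
  | EL a => pure a
  end.

Fixpoint ew (e : expr) : nat :=
  match e with
  | EV _ => 1
  | EC k => k.+1
  | EO _ a b => ew a + ew b
  | EL a => ew a
  end.

Definition bounded (h : nat) (s : state) :=
  (forall v, vars s v < 2 ^ h) /\ (forall a, cells s a < 2 ^ h).

Lemma ew_gt0 e : 0 < ew e.
Proof. by elim: e => //= o a IHa b IHb; lia. Qed.

Lemma eval_bound h e s : 0 < h -> bounded h s -> pure e -> eval e s < 2 ^ (ew e * h).
Proof.
move=> h_gt0 [bv bm]; elim: e => [v|k|o a IHa b IHb|a IHa] /=.
- by rewrite mul1n.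
- move=> _; apply: leq_trans (ltn_expl k (isT : 1 < 2)) _.
  by rewrite leq_exp2l //; nia.
- move=> /and3P[to /IHa {}IHa /IHb {}IHb].
  have A1 : 0 < ew a * h by rewrite muln_gt0 ew_gt0.
  have B1 : 0 < ew b * h by rewrite muln_gt0 ew_gt0.
  rewrite mulnDl expnD.
  have A2 : 1 < 2 ^ (ew a * h) by rewrite -{1}(expn0 2) ltn_exp2l.
  have B2 : 1 < 2 ^ (ew b * h) by rewrite -{1}(expn0 2) ltn_exp2l.
  set x := eval a s in IHa *; set y := eval b s in IHb *.
  have low z : z <= x -> z < 2 ^ (ew a * h) * 2 ^ (ew b * h) by nia.
  case: o to => // _ /=.
  + nia.
  + by apply: low; rewrite leq_subr.
  + nia.
  + by apply: low; rewrite leq_div.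
  + by apply: low; rewrite leq_mod.
  + by apply: low; rewrite leq_div.
- move=> pa; apply: leq_trans (bm _) _; rewrite leq_exp2l //.
  by have := ew_gt0 a; nia.
Qed.

Lemma pure_safe h w e s : 0 < h -> bounded h s -> pure e -> ew e * h <= w -> safe w e s.
Proof.
move=> h_gt0 bs; elim: e => [v|k|o a IHa b IHb|a IHa] pe le_w.
- by apply/andP; split => //; apply: leq_trans (eval_bound h_gt0 bs pe) _; rewrite leq_exp2l.
- by apply/andP; split => //; apply: leq_trans (eval_bound h_gt0 bs pe) _; rewrite leq_exp2l.
- apply/andP; split; first by apply: leq_trans (eval_bound h_gt0 bs pe) _; rewrite leq_exp2l.
  move: pe le_w => /= /and3P[_ pa pb] le_w; apply/andP; split; [apply: IHa|apply: IHb] => //; nia.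
- apply/andP; split; first by apply: leq_trans (eval_bound h_gt0 bs pe) _; rewrite leq_exp2l.
  exact: IHa.
Qed.

Lemma pure_args_safe h w e s : 0 < h -> bounded h s -> pure_args e -> ew e * h <= w ->
  eval e s < 2 ^ h -> safe w e s.
Proof.
move=> h_gt0 bs pe le_w lt_e.
have lt_w : eval e s < 2 ^ w.
  by apply: leq_trans lt_e _; rewrite leq_exp2l //; have := ew_gt0 e; nia.
case: e pe le_w lt_e lt_w => [v|k|o a b|a] pe le_w lt_e lt_w; apply/andP; split => //.
  move: pe le_w => /= /andP[pa pb] le_w.
  by apply/andP; split; apply: (pure_safe h_gt0 bs) => //; nia.
exact: (pure_safe h_gt0 bs).
Qed.

Fixpoint wf (c : cmd) : bool :=
  match c with
  | Skip => true
  | Asg _ e => pure_args e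
  | Sto a b => pure a && pure b
  | Seq c1 c2 => wf c1 && wf c2
  | Ite e c1 c2 => [&& pure e, wf c1 & wf c2]
  | Whl e c => pure e && wf c
  end.

Fixpoint cw (c : cmd) : nat :=
  match c with
  | Skip => 0
  | Asg _ e => ew e
  | Sto a b => ew a + ew b
  | Seq c1 c2 => cw c1 + cw c2
  | Ite e c1 c2 => ew e + cw c1 + cw c2
  | Whl e c => ew e + cw c
  end.

Lemma bounded_set_var h s v x : bounded h s -> x < 2 ^ h -> bounded h (set_var s v x).
Proof. by move=> [bv bm] lt_x; split => //= u; rewrite /upd; case: eqP. Qed.

Lemma bounded_set_mem h s a x : bounded h s -> x < 2 ^ h -> bounded h (set_mem s a x).
Proof. by move=> [bv bm] lt_x; split => //= u; rewrite /upd; case: eqP. Qed.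

Lemma exec_bounded h c s n s' : exec h c s n s' -> bounded h s -> bounded h s'.
Proof.
elim=> //; try (by move=> *; auto).
- by move=> *; apply: bounded_set_var.
- by move=> *; apply: bounded_set_mem.
Qed.

Lemma reach_jump w p o (cf : config) : placed p (pc cf) [:: IConst (tmp 0) 0; IJz (tmp 0) o] ->
  forall s, represents cf s -> exists cf', [/\ reach w p 2 cf cf', pc cf' = o & represents cf' s].
Proof.
move=> pl s [rv rm]; have pl0 := placed_onth pl.
have [_ /= /placed_onth pl1] := @placed_cat _ _ [:: _] [:: _] pl.
exists (Config o (upd (regs cf) (tmp 0) 0) (memory cf)); split => //.
  apply: (@reach_trans _ _ 1 1 _ (Config (pc cf).+1 (upd (regs cf) (tmp 0) 0) (memory cf))).
    by apply: (reach1 pl0); rewrite /= /set_reg expn_gt0.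
  by apply: (@reach1 _ _ _ _ (IJz (tmp 0) o)) ; first by move: pl1; rewrite addn1.
by split => //= v; rewrite /upd /tmp; case: eqP => //; lia.
Qed.

(** The cost [n] of the semantics is the exact number of RAM steps. The factor [cw c] on the word
    length depends on the program text alone, so the constant in [solves] absorbs it. *)
Theorem compile_correct h w p c s n s' : 0 < h -> exec h c s n s' -> bounded h s ->
  forall cf, wf c -> cw c * h <= w -> placed p (pc cf) (ccmd (pc cf) c) ->
  represents cf s ->
  exists cf', [/\ reach w p n cf cf', pc cf' = pc cf + csz c & represents cf' s'].
Proof.
move=> h_gt0; elim=> {c s n s'}.
- by move=> s _ cf _ _ _ rep; exists cf; rewrite addn0.
- move=> v e s lt_h bs cf /= pe le_w /placed_cat[ple]; rewrite size_cexpr => /placed_onth plo rep.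
  have se : safe w e s by apply: (pure_args_safe h_gt0 bs).
  have [c1 [r1 p1 v1 [rv1 rm1] k1]] := reach_expr ple se rep.
  exists (Config (pc c1).+1 (upd (regs c1) v.*2 (eval e s)) (memory c1)); split.
  + apply: reach_trans r1 _; apply: (@reach1 _ _ _ _ (IOp OOr v.*2 (tmp 0) (tmp 0))).
      by rewrite p1.
    by rewrite /= /set_reg /= v1 Nat.lor_diag (safe_eval se).
  + by rewrite /= p1; lia.
  + split => //= u; rewrite /upd; case: (u =P v) => [->|ne]; first by rewrite eqxx.
    by case: eqP => //; lia.
- move=> a b s lt_h bs cf /= /andP[pa pb] le_w /placed_cat[pla].
  rewrite size_cexpr => /placed_cat[plb]; rewrite size_cexpr => /placed_onth plo rep.
  have sa : safe w a s by apply: (pure_safe h_gt0 bs) => //; nia.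
  have sb : safe w b s by apply: (pure_safe h_gt0 bs) => //; nia.
  have [c1 [r1 p1 v1 rep1 k1]] := reach_expr pla sa rep.
  have [|c2 [r2 p2 v2 [rv2 rm2] k2]] := @reach_expr w p 1 b s c1 _ sb rep1; first by rewrite p1.
  exists (Config (pc c2).+1 (regs c2) (upd (memory c2) (eval a s) (eval b s))); split.
  + apply: reach_trans (reach_trans r1 r2) _; apply: (@reach1 _ _ _ _ (IStore (tmp 0) (tmp 1))).
      by rewrite p2 p1.
    by rewrite /= v2 k2 // v1.
  + by rewrite /= p2 p1; lia.
  + by split => //=; rewrite rm2.
- move=> c1 c2 s1 s2 s3 n1 n2 ex1 IH1 ex2 IH2 bs cf /= /andP[wf1 wf2] le_w /placed_cat[pl1].
  rewrite size_ccmd => pl2 rep.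
  have [|cf1 [r1 p1 rep1]] := IH1 bs cf wf1 _ pl1 rep; first by nia.
  have [||cf2 [r2 p2 rep2]] := IH2 (exec_bounded ex1 bs) cf1 wf2 _ _ rep1; first by nia.
    by rewrite p1.
  exists cf2; split => //; first exact: reach_trans r1 r2.
  by rewrite p2 p1 addnA.
- move=> e c1 c2 s s' n nz ex IH bs cf /= /and3P[pe wf1 wf2] le_w /placed_cat[ple].
  rewrite size_cexpr => /(@placed_cat _ _ [:: _])[/placed_onth plj] /=.
  move=> /placed_cat[pl1]; rewrite size_ccmd => /(@placed_cat _ _ [:: _; _])[plk _] rep.
  have se : safe w e s by apply: (pure_safe h_gt0 bs) => //; nia.
  have [d1 [r1 p1 v1 [rv1 rm1] k1]] := reach_expr ple se rep.
  have [|||d2 [r2 p2 rep2]] := IH bs (Config (pc d1).+1 (regs d1) (memory d1)) wf1.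
  + by nia.
  + by rewrite /= p1 -addn1.
  + by [].
  have pd2 : pc d2 = pc cf + esz e + 1 + csz c1 by rewrite p2 /= p1 addn1.
  rewrite -pd2 in plk; have [d3 [r3 p3 rep3]] := reach_jump w plk rep2.
  exists d3; split => //; last by rewrite p3; lia.
  apply: reach_trans (reach_trans r2 r3).
  apply: reach_trans r1 _; apply: (@reach1 _ _ _ _ (IJz _ _)); first by rewrite p1; exact: plj.
  by rewrite /= v1 (negbTE nz).
- move=> e c1 c2 s s' n z ex IH bs cf /= /and3P[pe wf1 wf2] le_w /placed_cat[ple].
  rewrite size_cexpr => /(@placed_cat _ _ [:: _])[/placed_onth plj] /=.
  move=> /placed_cat[_]; rewrite size_ccmd => /(@placed_cat _ _ [:: _; _])[_ /= pl2] rep.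
  have se : safe w e s by apply: (pure_safe h_gt0 bs) => //; nia.
  have [d1 [r1 p1 v1 [rv1 rm1] k1]] := reach_expr ple se rep.
  have [|||d2 [r2 p2 rep2]] :=
    IH bs (Config (pc cf + esz e + 1 + csz c1 + 2) (regs d1) (memory d1)) wf2.
  + by nia.
  + exact: pl2.
  + by [].
  exists d2; split => //; last by rewrite p2 /=; lia.
  apply: reach_trans r2.
  apply: reach_trans r1 _; apply: (@reach1 _ _ _ _ (IJz _ _)); first by rewrite p1; exact: plj.
  by rewrite /= v1 z eqxx.
- move=> e c s z bs cf /= /andP[pe wfc] le_w /placed_cat[ple].
  rewrite size_cexpr => /(@placed_cat _ _ [:: _])[/placed_onth plj] _ rep.
  have se : safe w e s by apply: (pure_safe h_gt0 bs) => //; nia.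
  have [d1 [r1 p1 v1 [rv1 rm1] k1]] := reach_expr ple se rep.
  exists (Config (pc cf + esz e + 1 + csz c + 2) (regs d1) (memory d1)); split => //.
    apply: reach_trans r1 _; apply: (@reach1 _ _ _ _ (IJz _ _)); first by rewrite p1; exact: plj.
    by rewrite /= v1 z eqxx.
  by rewrite /=; lia.
- move=> e c s1 s2 s3 n1 n2 nz ex1 IH1 ex2 IH2 bs cf wfw le_ww plw rep.
  move: (wfw) (le_ww) (plw) => /= /andP[pe wfc] le_w /placed_cat[ple].
  rewrite size_cexpr => /(@placed_cat _ _ [:: _])[/placed_onth plj] /=.
  move=> /placed_cat[pl1]; rewrite size_ccmd => plk.
  have se : safe w e s1 by apply: (pure_safe h_gt0 bs) => //; nia.
  have [d1 [r1 p1 v1 [rv1 rm1] k1]] := reach_expr ple se rep.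
  have [|||d2 [r2 p2 rep2]] := IH1 bs (Config (pc d1).+1 (regs d1) (memory d1)) wfc.
  + by nia.
  + by rewrite /= p1 -addn1.
  + by [].
  have pd2 : pc d2 = pc cf + esz e + 1 + csz c by rewrite p2 /= p1 addn1.
  rewrite -pd2 in plk; have [d3 [r3 p3 rep3]] := reach_jump w plk rep2.
  have [|d4 [r4 p4 rep4]] := IH2 (exec_bounded ex1 bs) d3 wfw le_ww _ rep3.
    by rewrite p3.
  exists d4; split => //; last by rewrite p4 p3.
  apply: reach_trans r4; apply: reach_trans (reach_trans r2 r3).
  apply: reach_trans r1 _; apply: (@reach1 _ _ _ _ (IJz _ _)); first by rewrite p1; exact: plj.
  by rewrite /= v1 (negbTE nz).
Qed.

(** * Total correctness with running times *)

(** Execution preserves [bounded h], so it is a premise here once and for all and never has to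
    appear in an invariant. *)
Definition spec (h : nat) (c : cmd) (s : state) (T : nat) (Q : state -> Prop) :=
  bounded h s -> exists s' n, [/\ exec h c s n s', n <= T & Q s'].

Fixpoint mods (P : pred nat) (c : cmd) : bool :=
  match c with
  | Skip | Sto _ _ => true
  | Asg v _ => P v
  | Seq c1 c2 | Ite _ c1 c2 => mods P c1 && mods P c2
  | Whl _ c => mods P c
  end.

Fixpoint nosto (c : cmd) : bool :=
  match c with
  | Skip | Asg _ _ => true
  | Sto _ _ => false
  | Seq c1 c2 | Ite _ c1 c2 => nosto c1 && nosto c2
  | Whl _ c => nosto c
  end.

Lemma exec_mods h c s n s' P : exec h c s n s' -> mods P c ->
  forall v, ~~ P v -> vars s' v = vars s v.
Proof.
elim=> {c s n s'} //=.
- by move=> v e s _ Pv u; rewrite /upd; case: eqP => // ->; rewrite Pv.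
- by move=> c1 c2 s1 s2 s3 n1 n2 _ IH1 _ IH2 /andP[m1 m2] v Pv; rewrite IH2 // IH1.
- by move=> e c1 c2 s s' n _ _ IH /andP[m1 m2]; apply: IH.
- by move=> e c1 c2 s s' n _ _ IH /andP[m1 m2]; apply: IH.
- by move=> e c s1 s2 s3 n1 n2 _ _ IH1 _ IH2 m v Pv; rewrite IH2 // IH1.
Qed.

Lemma exec_nosto h c s n s' : exec h c s n s' -> nosto c -> cells s' = cells s.
Proof.
elim=> {c s n s'} //=.
- by move=> c1 c2 s1 s2 s3 n1 n2 _ IH1 _ IH2 /andP[m1 m2]; rewrite IH2 // IH1.
- by move=> e c1 c2 s s' n _ _ IH /andP[m1 m2]; apply: IH.
- by move=> e c1 c2 s s' n _ _ IH /andP[m1 m2]; apply: IH.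
- by move=> e c s1 s2 s3 n1 n2 _ _ IH1 _ IH2 m; rewrite IH2 // IH1.
Qed.

Lemma mods_sub (P P' : pred nat) c : subpred P P' -> mods P c -> mods P' c.
Proof.
move=> sub; elim: c => //=.
- by move=> v e /sub.
- by move=> c1 IH1 c2 IH2 /andP[/IH1-> /IH2->].
- by move=> e c1 IH1 c2 IH2 /andP[/IH1-> /IH2->].
Qed.

Lemma spec_bounded h c s T Q : (bounded h s -> spec h c s T Q) -> spec h c s T Q.
Proof. by move=> sp bs; apply: sp. Qed.

Lemma spec_conseq h c s T T' Q Q' : spec h c s T' Q' -> T' <= T ->
  (forall s', Q' s' -> Q s') -> spec h c s T Q.
Proof.
move=> sp le_T QQ bs; have [s' [n [ex le_n q]]] := sp bs.
by exists s', n; split; [|exact: leq_trans le_n le_T|exact: QQ].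
Qed.

(** A syntactic frame rule: invariants then speak only of what a command assigns. *)
Lemma spec_frame h c s T Q P : spec h c s T Q -> mods P c ->
  spec h c s T (fun s' => [/\ Q s', forall v, ~~ P v -> vars s' v = vars s v
    & nosto c -> cells s' = cells s]).
Proof.
move=> sp md bs; have [s' [n [ex le_n q]]] := sp bs.
exists s', n; split => //; split => //; first exact: exec_mods ex md.
exact: exec_nosto ex.
Qed.

Lemma spec_skip h s T (Q : state -> Prop) : Q s -> spec h Skip s T Q.
Proof. by move=> q bs; exists s, 0; split => //; exact: ExSkip. Qed.

Lemma spec_asg h v e s T (Q : state -> Prop) : esz e + 1 <= T -> eval e s < 2 ^ h ->
  Q (set_var s v (eval e s)) -> spec h (Asg v e) s T Q.
Proof.
move=> le_T lt_h q bs; exists (set_var s v (eval e s)), (esz e + 1).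
by split => //; exact: ExAsg.
Qed.

Lemma spec_sto h a b s T (Q : state -> Prop) : esz a + esz b + 1 <= T ->
  eval b s < 2 ^ h -> Q (set_mem s (eval a s) (eval b s)) -> spec h (Sto a b) s T Q.
Proof.
move=> le_T lt_h q bs; exists (set_mem s (eval a s) (eval b s)), (esz a + esz b + 1).
by split => //; exact: ExSto.
Qed.

Lemma spec_seq h c1 c2 s T1 T (Q Q1 : state -> Prop) : T1 <= T -> spec h c1 s T1 Q1 ->
  (forall s', Q1 s' -> spec h c2 s' (T - T1) Q) -> spec h (Seq c1 c2) s T Q.
Proof.
move=> le_T sp1 sp2 bs; have [s1 [n1 [ex1 le1 q1]]] := sp1 bs.
have [s2 [n2 [ex2 le2 q2]]] := sp2 s1 q1 (exec_bounded ex1 bs).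
by exists s2, (n1 + n2); split => //; [exact: ExSeq ex1 ex2|lia].
Qed.

Lemma spec_asg_seq h v e c s T Q : esz e + 1 <= T -> eval e s < 2 ^ h ->
  spec h c (set_var s v (eval e s)) (T - (esz e + 1)) Q ->
  spec h (Seq (Asg v e) c) s T Q.
Proof.
move=> le_T lt_h sp.
apply: (@spec_seq _ _ _ _ (esz e + 1) _ _ (fun s' => s' = set_var s v (eval e s))) => //.
  exact: spec_asg.
by move=> s' ->.
Qed.

Lemma spec_asg_val h v e x c s T Q : eval e s = x -> esz e + 1 <= T -> x < 2 ^ h ->
  spec h c (set_var s v x) (T - (esz e + 1)) Q -> spec h (Seq (Asg v e) c) s T Q.
Proof. by move=> <-; apply: spec_asg_seq. Qed.

Lemma spec_sto_seq h a b c s T Q : esz a + esz b + 1 <= T -> eval b s < 2 ^ h ->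
  spec h c (set_mem s (eval a s) (eval b s)) (T - (esz a + esz b + 1)) Q ->
  spec h (Seq (Sto a b) c) s T Q.
Proof.
move=> le_T lt_h sp.
apply: (@spec_seq _ _ _ _ (esz a + esz b + 1) _ _
  (fun s' => s' = set_mem s (eval a s) (eval b s))) => //.
  exact: spec_sto.
by move=> s' ->.
Qed.

Lemma spec_ite h e c1 c2 s T Q : esz e + 3 <= T ->
  (eval e s != 0 -> spec h c1 s (T - (esz e + 3)) Q) ->
  (eval e s = 0 -> spec h c2 s (T - (esz e + 3)) Q) ->
  spec h (Ite e c1 c2) s T Q.
Proof.
move=> le_T sp1 sp2 bs; case: (eqVneq (eval e s) 0) => [z|nz].
  have [s' [n [ex le_n q]]] := sp2 z bs.
  by exists s', (esz e + 1 + n); split => //; [exact: ExElse|lia].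
have [s' [n [ex le_n q]]] := sp1 nz bs.
by exists s', (esz e + 1 + (n + 2)); split => //; [exact: ExThen|lia].
Qed.

Definition For (i : nat) (e : expr) (c : cmd) : cmd :=
  Seq (Asg i (EC 0))
      (Whl (EO OSub e (EV i)) (Seq c (Asg i (EO OAdd (EV i) (EC 1))))).

(** A round costs [esz e + 3] for the test, [Tb] for the body, 4 for the increment and 2 for the
    jump back; the remaining [esz e + 5] are the initialisation and the failing test. The bound [e]
    is evaluated anew in every round, hence the condition that it depend only on variables outside
    [P]. *)
Lemma spec_for h i e c s0 N T Tb (P : pred nat) (I : nat -> state -> Prop)
    (Q : state -> Prop) :
  N < 2 ^ h -> P i -> mods (fun v => P v && (v != i)) c ->
  (forall s, (forall v, ~~ P v -> vars s v = vars s0 v) -> eval e s = N) ->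
  I 0 (set_var s0 i 0) ->
  (forall k s, k < N -> vars s i = k ->
     (forall v, ~~ P v -> vars s v = vars s0 v) ->
     (nosto c -> cells s = cells s0) -> I k s ->
     spec h c s Tb (fun s' => I k.+1 (set_var s' i k.+1))) ->
  (forall s, vars s i = N -> (forall v, ~~ P v -> vars s v = vars s0 v) ->
     (nosto c -> cells s = cells s0) -> I N s -> Q s) ->
  N * (Tb + esz e + 9) + esz e + 5 <= T ->
  spec h (For i e c) s0 T Q.
Proof.
move=> lt_N Pi md ev I0 IS IQ le_T.
apply: spec_asg_seq; first by rewrite /=; lia.
  by rewrite /= expn_gt0.
rewrite /=.
have main : forall d k s T', k + d = N -> vars s i = k ->
    (forall v, ~~ P v -> vars s v = vars s0 v) -> (nosto c -> cells s = cells s0) ->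
    I k s -> d * (Tb + esz e + 9) + esz e + 3 <= T' ->
    spec h (Whl (EO OSub e (EV i)) (Seq c (Asg i (EO OAdd (EV i) (EC 1))))) s T' Q.
  elim=> [|d IH] k s T' kd vi fr me Ik le_T' bs.
    move: kd; rewrite addn0 => kN; rewrite kN in vi Ik.
    exists s, (esz e + 1 + 1 + 1); split; last exact: IQ.
      by apply: ExDone; rewrite /= ev // vi; lia.
    lia.
  have lt_k : k < N by lia.
  have [s1 [n1 [ex1 le1 I1]]] := IS k s lt_k vi fr me Ik bs.
  have vi1 : vars s1 i = k by rewrite (exec_mods ex1 md) // eqxx andbF.
  pose s2 := set_var s1 i k.+1.
  have ex2 : exec h (Asg i (EO OAdd (EV i) (EC 1))) s1 (1 + 1 + 1 + 1) s2.
    by have := @ExAsg h i (EO OAdd (EV i) (EC 1)) s1; rewrite /= vi1 addn1; apply; lia.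
  have ex12 := ExSeq ex1 ex2.
  have sp3 : spec h (Whl (EO OSub e (EV i)) (Seq c (Asg i (EO OAdd (EV i) (EC 1))))) s2
      (d * (Tb + esz e + 9) + esz e + 3) Q.
    apply: (IH k.+1) => //; first by lia.
    - by rewrite /= /upd eqxx.
    - move=> v Pv; rewrite /= /upd; case: eqP => [vv|_]; first by rewrite vv Pi in Pv.
      by rewrite (exec_mods ex1 md) ?(negbTE Pv) // fr.
    - by move=> ns; rewrite /= (exec_nosto ex1 ns) me.
  have [s3 [n3 [ex3 le3 q3]]] := sp3 (exec_bounded ex12 bs).
  exists s3, (esz e + 1 + 1 + 1 + (n1 + (1 + 1 + 1 + 1) + 2) + n3); split => //.
    apply: (ExIter _ ex12 ex3); rewrite /= ev // vi; lia.
  move: le_T'; rewrite mulSn; lia.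
apply: (main N 0) => //; last by lia.
- by rewrite /= /upd eqxx.
- by move=> v Pv; rewrite /= /upd; case: eqP => // vi; rewrite vi Pi in Pv.
Qed.

(** * An interpreter for word-RAM programs *)

(* Cell [a] of the interpreted program is kept at [base + 2a], next to a stamp at
   [base + 2a + 1]; it counts as zero unless its stamp is the number [cur] of the
   current call, so that no cleaning is needed between calls. *)
Definition vmem (base cur : nat) (M : nat -> nat) (a : nat) : nat :=
  if M (base + 2 * a + 1) == cur then M (base + 2 * a) else 0.

(** No stamp lies in the future: increasing the call number makes every cell read as 0 at once. *)
Definition stamped (base cur : nat) (M : nat -> nat) :=
  forall a, M (base + 2 * a + 1) <= cur.

Definition vBASE := 6.
Definition vCUR := 7.
Definition vPC := 27.
Definition vREG (r : nat) := 28 + r.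

Definition eadd := EO OAdd.
Definition esub := EO OSub.
Definition emul := EO OMul.
Definition ediv := EO ODiv.
Definition emod := EO OMod.
Definition eeq (a b : expr) := esub (EC 1) (eadd (esub a b) (esub b a)).
Definition vaddr (a : expr) := eadd (EV vBASE) (emul (EC 2) a).
Definition vload (a : expr) :=
  emul (EL (vaddr a)) (eeq (EL (eadd (vaddr a) (EC 1))) (EV vCUR)).
Definition vstore (a v : expr) :=
  Seq (Sto (vaddr a) v) (Sto (eadd (vaddr a) (EC 1)) (EV vCUR)).

Lemma eval_eeq a b s : eval (eeq a b) s = (eval a s == eval b s).
Proof. by rewrite /=; case: eqP; lia. Qed.

Lemma eval_vload a s :
  eval (vload a) s = vmem (vars s vBASE) (vars s vCUR) (cells s) (eval a s).
Proof.
have eval_mul x y : eval (emul x y) s = eval x s * eval y s by [].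
rewrite eval_mul eval_eeq /= /vmem.
by case: eqP => _; rewrite ?muln1 ?muln0.
Qed.

Definition low_eq (base : nat) (M M' : nat -> nat) := forall a, a < base -> M' a = M a.

Lemma vmem_store base cur M a v :
  let M' := upd (upd M (base + 2 * a) v) (base + 2 * a + 1) cur in
  [/\ forall a', vmem base cur M' a' = upd (vmem base cur M) a v a',
      stamped base cur M -> stamped base cur M' & low_eq base M M'].
Proof.
split.
- move=> a'; rewrite /vmem /upd; case: (a' =P a) => [->|ne].
    have -> : (base + 2 * a == base + 2 * a + 1) = false by lia.
    by rewrite !eqxx.
  have -> : (base + 2 * a' + 1 == base + 2 * a + 1) = false by lia.
  have -> : (base + 2 * a' + 1 == base + 2 * a) = false by lia.
  have -> : (base + 2 * a' == base + 2 * a + 1) = false by lia.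
  by have -> : (base + 2 * a' == base + 2 * a) = false by lia.
- move=> st a'; rewrite /upd; case: ifP => // _; case: ifP => [|_]; first by lia.
  exact: st.
- by move=> a' lt_a; rewrite /upd !ifF //; lia.
Qed.

Lemma spec_vstore h a v s T (Q : state -> Prop) :
  2 * esz a + esz v + 13 <= T -> eval v s < 2 ^ h ->
  (forall s', vars s' = vars s ->
     (forall x, vmem (vars s vBASE) (vars s vCUR) (cells s') x =
        upd (vmem (vars s vBASE) (vars s vCUR) (cells s)) (eval a s) (eval v s) x) ->
     (stamped (vars s vBASE) (vars s vCUR) (cells s) ->
      stamped (vars s vBASE) (vars s vCUR) (cells s')) ->
     low_eq (vars s vBASE) (cells s) (cells s') -> Q s') ->
  (forall M, eval a (State (vars s) M) = eval a s) ->
  spec h (vstore a v) s T Q.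
Proof.
move=> le_T lt_v q ea; apply: spec_bounded => bs.
apply: spec_sto_seq => //; first by rewrite /=; lia.
apply: spec_sto; first by rewrite /=; lia.
  exact: bs.1.
have [v1 v2 v3] := vmem_store (vars s vBASE) (vars s vCUR) (cells s) (eval a s) (eval v s).
by apply: q => //=; rewrite ea.
Qed.

Definition simulate (i : instr) : cmd :=
  let next := Asg vPC (eadd (EV vPC) (EC 1)) in
  match i with
  | IConst r k => Seq (Asg (vREG r) (EC k)) next
  | IOp o r a b => Seq (Asg (vREG r) (EO o (EV (vREG a)) (EV (vREG b)))) next
  | ILoad r a => Seq (Asg (vREG r) (vload (EV (vREG a)))) next
  | IStore a b => Seq (vstore (EV (vREG a)) (EV (vREG b))) next
  | IJz a l => Ite (EV (vREG a)) next (Asg vPC (EC l))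
  end.

(** [k.+1 - vPC] is nonzero exactly when [vPC <= k], and the earlier tests have excluded smaller
    values. The interpreted program is fixed, so this linear dispatch costs a constant factor. *)
Fixpoint switch (k : nat) (p : program) : cmd :=
  match p with
  | [::] => Skip
  | i :: p => Ite (esub (EC k.+1) (EV vPC)) (simulate i) (switch k.+1 p)
  end.

Fixpoint clear (r : nat) : cmd :=
  match r with
  | 0 => Asg vPC (EC 0)
  | r.+1 => Seq (Asg (vREG r) (EC 0)) (clear r)
  end.

Definition instr_regs (i : instr) : seq nat :=
  match i with
  | IConst r _ => [:: r]
  | IOp _ r a b => [:: r; a; b]
  | ILoad r a => [:: r; a]
  | IStore a b => [:: a; b]
  | IJz a _ => [:: a]
  end.

Definition nregs (p : program) : nat := \max_(r <- flatten (map instr_regs p)) r.+1.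

Definition jump_bound (p : program) : nat :=
  \max_(l <- map (fun i => if i is IJz _ l then l else 0) p) l.

Definition call (p : program) : cmd :=
  Seq (clear (nregs p)) (Whl (esub (EC (size p)) (EV vPC)) (switch 0 p)).

Lemma wf_switch k p : wf (switch k p).
Proof. by elim: p k => //= i p IH k; rewrite IH andbT; case: i. Qed.

Lemma wf_call p : wf (call p).
Proof. by rewrite /= wf_switch andbT; elim: (nregs p). Qed.

Lemma mods_switch k p : mods (fun v => 27 <= v) (switch k p).
Proof. by elim: p k => // i p IH k; apply/andP; split; [case: i|exact: IH]. Qed.

Lemma mods_call p : mods (fun v => 27 <= v) (call p).
Proof.
apply/andP; split; first by elim: (nregs p).
exact: mods_switch.
Qed.

Definition simulates (base cur R : nat) (M0 : nat -> nat) (c : config) (s : state) :=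
  [/\ vars s vBASE = base /\ vars s vCUR = cur, vars s vPC = pc c,
      forall r, r < R -> vars s (vREG r) = regs c r,
      forall a, vmem base cur (cells s) a = memory c a &
      stamped base cur (cells s) /\ low_eq base M0 (cells s)].

Lemma spec_simulate h w base cur R M0 p i c c' s : w <= h -> size p < 2 ^ h ->
  onth p (pc c) = Some i -> exec_instr w i c = Some c' ->
  all (fun r => r < R) (instr_regs i) -> (if i is IJz _ l then l < 2 ^ h else true) ->
  simulates base cur R M0 c s ->
  spec h (simulate i) s 40 (simulates base cur R M0 c').
Proof.
move=> le_wh szp pi ex ri ji [[sb sc] sp sr sm [st lo]].
have lt_pc : (pc c).+1 < 2 ^ h.
  by apply: leq_ltn_trans szp; elim: (p) (pc c) pi => [|j q IH] [|k] //= /IH.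
have lt_w v : v < 2 ^ w -> v < 2 ^ h.
  by move=> lt_v; apply: leq_trans lt_v _; rewrite leq_exp2l.
have upreg v r : r < R -> vars s (vREG r) = regs c r ->
    forall x, upd (vars s) (vREG v) x (vREG r) = upd (regs c) v x r.
  by move=> lt_r e x; rewrite /upd eqn_add2l e.
have next (s' : state) (reg me : nat -> nat) T :
    simulates base cur R M0 (Config (pc c) reg me) s' -> 4 <= T ->
    spec h (Asg vPC (eadd (EV vPC) (EC 1))) s' T
      (simulates base cur R M0 (Config (pc c).+1 reg me)).
  move=> [[b' c0] p' r' m' sl'] le_T; apply: spec_asg => //=.
    by rewrite p' addn1.
  by split => //; rewrite /upd /= p' addn1.
case: i pi ex ri ji => [r k|o r a b|r a|a b|a l] pi /=; rewrite /set_reg.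
- case: ifP => // /lt_w lt_k [<-] /andP[lt_r _] _.
  apply: spec_asg_seq => //=; apply: next => //; split => //= q lt_q.
  by rewrite upreg ?sr.
- case: ifP => // /lt_w lt_k [<-] /and4P[lt_r lt_a lt_b _] _.
  apply: spec_asg_seq => //=; first by rewrite !sr.
  apply: next => //; split => //= q lt_q.
  by rewrite upreg ?sr.
- case: ifP => // /lt_w lt_k [<-] /and3P[lt_r lt_a _] _.
  have ev : eval (vload (EV (vREG a))) s = memory c (regs c a).
    by rewrite eval_vload sb sc sm /= sr.
  apply: spec_asg_seq => //; first by rewrite ev.
  rewrite ev; apply: next => //; split => //= q lt_q.
  by rewrite upreg ?sr.
- move=> [<-] /and3P[lt_a lt_b _] _.
  apply: spec_bounded => -[bv _].
  apply: (@spec_seq _ _ _ _ 20 _ _ (simulates base cur R M0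
      (Config (pc c) (regs c) (upd (memory c) (regs c a) (regs c b))))) => //.
    apply: spec_vstore => //; first exact: bv.
    move=> s' vs'; rewrite sb sc /= !sr // => vm' st' lo'; split => //.
    + by rewrite vs'.
    + by rewrite vs'.
    + by move=> q lt_q; rewrite vs' sr.
    + by move=> x; rewrite vm' /= /upd sm.
    + by split; [exact: st'|move=> x lt_x; rewrite lo' // lo].
  by move=> s' sim; apply: next.
- move=> [<-] /andP[lt_a _] lt_l; apply: spec_ite => //=; rewrite sr //.
    by move=> /negbTE->; apply: next.
  move=> ->; rewrite eqxx; apply: spec_asg => //=.
Qed.

Lemma spec_switch h w base cur R M0 p c c' s : w <= h -> size p < 2 ^ h ->
  step w p c = Some c' -> nregs p <= R -> jump_bound p < 2 ^ h ->
  simulates base cur R M0 c s ->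
  spec h (switch 0 p) s (6 * size p + 40) (simulates base cur R M0 c').
Proof.
move=> le_wh szp st_ le_R lt_j sim.
have [i pi ex] : exists2 i, onth p (pc c) = Some i & exec_instr w i c = Some c'.
  by move: st_; rewrite /step; case: (onth p (pc c)) => // i; exists i.
have ip : exists2 q, q ++ i :: drop (pc c).+1 p = p & size q = pc c.
  exists (take (pc c) p).
    by elim: (p) (pc c) pi => [|j q IH] [|k] //= => [[->]|/IH->] //; rewrite drop0.
  by rewrite size_takel //; elim: (p) (pc c) pi => [|j q IH] [|k] //= /IH.
have [q def_p sz_q] := ip.
have lt_q : pc c < size p by rewrite -def_p size_cat /=; lia.
have spi : spec h (simulate i) s 40 (simulates base cur R M0 c').
  apply: (spec_simulate le_wh szp pi ex) sim.
    apply/allP => r ri; apply: leq_trans le_R; rewrite /nregs.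
    apply: (@leq_bigmax_seq _ _ _ (fun r => r.+1) r) => //.
    by rewrite -def_p map_cat flatten_cat mem_cat /= mem_cat ri orbT.
  clear ip pi ex; case: i def_p => // a l def_p; apply: leq_ltn_trans lt_j.
  rewrite /jump_bound.
  apply: (@leq_bigmax_seq _ _ _ id l) => //.
  by rewrite -def_p map_cat mem_cat /= in_cons eqxx orbT.
have vp : vars s vPC = pc c by case: sim.
have {def_p} : q ++ i :: drop (pc c).+1 p = p by [].
move: (drop _ p) => q'.
have : forall k T, k + size q = pc c -> 6 * size q + 46 <= T ->
   spec h (switch k (q ++ i :: q')) s T (simulates base cur R M0 c').
  elim: (q) => [|j q1 IH] k T /= ek le_T.
    apply: spec_ite => /=; rewrite ?vp; first by lia.
      by move=> _; apply: (spec_conseq spi) => //; lia.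
    by move=> ?; exfalso; lia.
  apply: spec_ite => /=; rewrite ?vp; first by lia.
    by move=> ?; exfalso; lia.
  by move=> _; apply: IH; lia.
move=> main def_p; rewrite -def_p; apply: main => //; rewrite size_cat /=; lia.
Qed.

Lemma spec_clear h R s (Q : state -> Prop) :
  (forall s', vars s' vPC = 0 -> (forall r, r < R -> vars s' (vREG r) = 0) ->
     (forall v, v < 27 -> vars s' v = vars s v) -> cells s' = cells s -> Q s') ->
  spec h (clear R) s (2 * R + 2) Q.
Proof.
elim: R s Q => [|R IH] s Q q.
  apply: spec_asg => //; first by rewrite /= expn_gt0.
  by apply: q => // v lt_v; rewrite /= /upd ifF // /vPC; lia.
apply: spec_asg_seq => /=; [lia|by rewrite expn_gt0|].
apply: (@spec_conseq _ _ _ _ (2 * R + 2) _ (fun s' => [/\ vars s' vPC = 0,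
    forall r, r < R.+1 -> vars s' (vREG r) = 0,
    forall v, v < 27 -> vars s' v = vars s v & cells s' = cells s])).
- have md : mods (fun v => (27 <= v) && (v != vREG R)) (clear R).
    have : forall k, k <= R -> mods (fun v => (27 <= v) && (v != vREG R)) (clear k).
      elim=> // k IHk lt_k; apply/andP; split; last by apply: IHk; lia.
      by rewrite /= /vREG; lia.
    exact.
  apply: (spec_conseq (spec_frame (IH _ (fun s' => [/\ vars s' vPC = 0,
    forall r, r < R -> vars s' (vREG r) = 0 & cells s' = cells s]) _) md)) => //.
  move=> s' [[p0 r0 m0] fr _]; split => //.
    move=> r; rewrite ltnS leq_eqVlt => /orP[/eqP->|]; last exact: r0.
    by rewrite fr ?eqxx ?andbF //= /upd eqxx.
  move=> v lt_v; rewrite fr; last by lia.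
  by rewrite /= /upd; case: eqP => //; rewrite /vREG; lia.
- lia.
- by move=> s' [*]; apply: q.
Qed.

(** The interpreted run succeeds with [w]-bit words, so each value it writes to a register already
    fits into [w <= h] bits, and the larger words of the host change nothing. *)
Lemma spec_call h w base cur p x k c s (Q : state -> Prop) : w <= h ->
  size p < 2 ^ h -> jump_bound p < 2 ^ h -> halts_in w p (init x) k c ->
  vars s vBASE = base -> vars s vCUR = cur ->
  (forall a, vmem base cur (cells s) a = nth 0 x a) -> stamped base cur (cells s) ->
  (forall s', (forall v, v < 27 -> vars s' v = vars s v) ->
     (forall a, vmem base cur (cells s') a = memory c a) ->
     stamped base cur (cells s') -> low_eq base (cells s) (cells s') -> Q s') ->
  spec h (call p) s ((6 * size p + 50) * k + 2 * nregs p + 10) Q.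
Proof.
move=> le_wh szp lt_j [hk ge_pc] sb sc sv st q.
apply: (@spec_conseq _ _ _ _ ((6 * size p + 50) * k + 2 * nregs p + 10) _ (fun s' =>
  [/\ simulates base cur (nregs p) (cells s) c s', forall v, ~~ (27 <= v) -> vars s' v = vars s v
   & nosto (call p) -> cells s' = cells s])).
- apply: spec_frame (mods_call p).
  apply: (@spec_seq _ _ _ _ (2 * nregs p + 2) _ _ (simulates base cur (nregs p) (cells s) (init x))).
  + lia.
  + apply: spec_clear => s' p0 r0 fr me; split => //.
    * by split; rewrite fr.
    * by rewrite me.
    * by rewrite me; split.
  move=> s1 sim.
  have le_T : (6 * size p + 50) * k + 5 <=
      (6 * size p + 50) * k + 2 * nregs p + 10 - (2 * nregs p + 2).
    by lia.
  move: (_ - _) le_T => T le_T.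
  elim: k (init x) hk {sv q} s1 sim T le_T => [|k IH] c0 hk s1 sim T le_T bs.
    case: hk sim => -> sim; exists s1, 4; split => //; last by lia.
    by apply: (@ExDone h (esub (EC (size p)) (EV vPC))) => /=; case: sim => _ -> *; lia.
  move: hk; rewrite iterSr /=; case st0 : (step w p c0) => [c1|]; last first.
    by rewrite (_ : iter k _ None = None) //; elim: (k) => //= j ->.
  move=> hk.
  have [s2 [n2 [ex2 le2 sim2]]] := spec_switch le_wh szp st0 (leqnn _) lt_j sim bs.
  have [s3 [n3 [ex3 le3 sim3]]] := IH c1 hk s2 sim2 _ (leqnn _) (exec_bounded ex2 bs).
  exists s3, (3 + 1 + (n2 + 2) + n3); split => //; last by lia.
  apply: (ExIter _ ex2 ex3) => /=.
  have : pc c0 < size p.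
    move: st0; rewrite /step; case pi : (onth p (pc c0)) => [i|] // _.
    by elim: (p) (pc c0) pi => [|j q' IH'] [|j'] //= /IH'.
  by case: sim => _ -> *; lia.
- by [].
- move=> s' [[_ _ _ sm [ss sl]] fr _]; apply: q => //.
  by move=> v lt_v; apply: fr; lia.
Qed.

(** * Positional notation *)

Definition digit (q i N : nat) : nat := N %/ q ^ i %% q.

Fixpoint from_digits (q d : nat) (f : nat -> nat) : nat :=
  if d is d'.+1 then f 0 + q * from_digits q d' (fun i => f i.+1) else 0.

Lemma digit0 q N : digit q 0 N = N %% q.
Proof. by rewrite /digit expn0 divn1. Qed.

Lemma digitS q i N : digit q i.+1 N = digit q i (N %/ q).
Proof. by rewrite /digit expnS divnMA. Qed.

Lemma digit_lt q i N : 0 < q -> digit q i N < q.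
Proof. by move=> q_gt0; rewrite /digit ltn_pmod. Qed.

Lemma eq_from_digits q d f g : (forall i, i < d -> f i = g i) ->
  from_digits q d f = from_digits q d g.
Proof.
elim: d f g => //= d IH f g fg; rewrite fg //; congr (_ + _ * _).
by apply: IH => i lt_i; apply: fg.
Qed.

Lemma from_digits_lt q d f : (forall i, i < d -> f i < q) -> from_digits q d f < q ^ d.
Proof.
elim: d f => [|d IH] f lt_f /=; first by rewrite expn0.
have := lt_f 0 isT; have := IH (fun i => f i.+1) (fun i lt_i => lt_f i.+1 lt_i).
rewrite expnS; move: (from_digits _ _ _) (q ^ d) => a b; nia.
Qed.

Lemma from_digits_div q d f : f 0 < q ->
  from_digits q d.+1 f %/ q = from_digits q d (fun i => f i.+1).
Proof.
by move=> lt_f /=; rewrite addnC mulnC divnMDl ?divn_small ?addn0 //; lia.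
Qed.

Lemma from_digits_modn q d f : f 0 < q -> from_digits q d.+1 f %% q = f 0.
Proof. by move=> lt_f /=; rewrite addnC mulnC modnMDl modn_small. Qed.

Lemma digit_from_digits q d f i : (forall i, i < d -> f i < q) -> i < d ->
  digit q i (from_digits q d f) = f i.
Proof.
elim: i d f => [|i IH] [|d] f lt_f // lt_i.
  by rewrite digit0 from_digits_modn ?lt_f.
by rewrite digitS from_digits_div ?lt_f // (IH d) // => j lt_j; apply: lt_f.
Qed.

Lemma digit_modn q i d N : i < d -> digit q i (N %% q ^ d) = digit q i N.
Proof.
move=> lt_i; case: (posnP q) => [->|q_gt0].
  by rewrite /digit !modn0; case: d lt_i => // d _; rewrite exp0n // modn0.
have dE : q ^ d = q ^ (d - i.+1) * q * q ^ i by rewrite -expnSr -expnD; congr (_ ^ _); lia.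
rewrite /digit [in RHS](divn_eq N (q ^ d)) {3}dE mulnA divnMDl ?expn_gt0 ?q_gt0 //.
by rewrite mulnA modnMDl.
Qed.

Lemma from_digits_digit q d N : N < q ^ d -> from_digits q d (digit q ^~ N) = N.
Proof.
elim: d N => [|d IH] N lt_N /=; first by rewrite expn0 in lt_N; lia.
rewrite digit0 (@eq_from_digits _ _ _ (digit q ^~ (N %/ q))); last first.
  by move=> i _; rewrite digitS.
rewrite IH; first by rewrite addnC mulnC -divn_eq.
by rewrite ltn_divLR -?expnSr //; case: q lt_N {IH}; rewrite ?exp0n.
Qed.

Lemma from_digits_mod_exp q d f : (forall i, i < d.+1 -> f i < q) ->
  from_digits q d.+1 f %% q ^ d = from_digits q d f.
Proof.
move=> lt_f; have q_gt0 : 0 < q by apply: leq_ltn_trans (lt_f 0 isT).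
rewrite -[LHS](@from_digits_digit q d) ?ltn_pmod ?expn_gt0 ?q_gt0 //.
apply: eq_from_digits => i lt_i; rewrite digit_modn // digit_from_digits //; lia.
Qed.

(** * Directed cycles of natural numbers *)

Lemma cycle_nth (T : Type) (r : rel T) (x0 : T) (c : seq T) :
  reflect (forall i, i < size c -> r (nth x0 c i) (nth x0 c (i.+1 %% size c)))
          (cycle r c).
Proof.
case: c => [|x p]; first by apply: ReflectT.
have nthE i : i < size (x :: p) ->
    nth x0 (rcons p x) i = nth x0 (x :: p) (i.+1 %% size (x :: p)).
  rewrite /= ltnS leq_eqVlt => /orP[/eqP->|lt_i].
    by rewrite modnn nth_rcons ltnn eqxx.
  by rewrite modn_small //= nth_rcons lt_i.
have nthF i : i < size (x :: p) -> nth x0 (x :: rcons p x) i = nth x0 (x :: p) i.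
  by case: i => //= i; rewrite ltnS nth_rcons => ->.
apply: (iffP (pathP x0)) => H i lt_i.
  by rewrite -nthE // -nthF //; apply: H; rewrite size_rcons.
by rewrite size_rcons in lt_i; rewrite nthE // nthF //; apply: H.
Qed.

Definition nat_edges (G : digraph) : seq (nat * nat) :=
  [seq (val e.1, val e.2) | e <- edges G].

(** Frees the graph arguments from the ordinals of the vertex type: each number on a cycle is an end
    of an edge and therefore a vertex. *)
Lemma has_cycleP (L : nat) (G : digraph) :
  reflect (exists c : seq nat, [/\ size c = L, uniq c
             & cycle (fun u v => (u, v) \in nat_edges G) c])
          (has_cycle L G).
Proof.
have memE (u v : 'I_(nverts G)) : ((val u, val v) \in nat_edges G) = ((u, v) \in edges G).
  rewrite /nat_edges; apply: (mem_map (f := fun e => (val e.1, val e.2)) _ (edges G) (u, v)).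
  by move=> [a b] [a' b'] /= [/val_inj -> /val_inj ->].
apply: (iffP existsP) => [[c /andP[uc cc]]|[c [sz uc cc]]].
  exists (map val c); split; rewrite ?size_map ?size_tuple ?(map_inj_uniq val_inj) //.
  rewrite cycle_map; apply: sub_cycle cc => u v /=; rewrite -memE //.
have lt_c : all (fun x => x < nverts G) c.
  apply/(all_nthP 0) => i lt_i.
  have /mapP[[a b] _ [-> _]] := (cycle_nth _ 0 c cc) i lt_i.
  exact: ltn_ord.
have [c' def_c] : exists c' : seq 'I_(nverts G), map val c' = c.
  elim: c lt_c {sz uc cc} => [|x c IH] /=; first by exists [::].
  by move=> /andP[lt_x /IH[c' <-]]; exists (Ordinal lt_x :: c').
have sz' : size c' == L by rewrite -sz -def_c size_map.
exists (Tuple sz'); rewrite -def_c in uc cc.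
rewrite (map_inj_uniq val_inj) in uc; rewrite uc /=.
by rewrite cycle_map in cc; apply: sub_cycle cc => u v /=; rewrite -memE.
Qed.

(** A sigma type, because the query graphs are needed as a function of the guess. *)
Lemma digraph_of_nat_edges (N : nat) (E : seq (nat * nat)) :
  uniq E -> all (fun e => [&& e.1 < N, e.2 < N & e.1 != e.2]) E ->
  {G : digraph | nverts G = N /\ nat_edges G = E}.
Proof.
move=> uE aE.
have [es def_E] : {es : seq ('I_N * 'I_N) | [seq (val e.1, val e.2) | e <- es] = E}.
  elim: E aE {uE} => [|[a b] E IH] /=; first by exists [::].
  move=> /andP[/and3P[lt_a lt_b _] /IH[es <-]].
  by exists ((Ordinal lt_a, Ordinal lt_b) :: es).
have ue : uniq es by apply: (@map_uniq _ _ (fun e => (val e.1, val e.2))); rewrite def_E.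
have le : all (fun e => e.1 != e.2) es.
  move: aE; rewrite -def_E all_map; apply: sub_all => e /= /and3P[_ _].
  by rewrite -(inj_eq val_inj).
by exists (Digraph ue le).
Qed.

Lemma digraph_input_nat G : digraph_input G =
  [:: nverts G, size (nat_edges G) & flatten [seq [:: e.1; e.2] | e <- nat_edges G]].
Proof. by rewrite /digraph_input /nedges /nat_edges size_map -map_comp. Qed.

(** * The layered graph *)

Section Layered.

Variables (L g Z M0 : nat) (ok : nat -> nat -> bool).
Hypotheses (L_gt1 : 1 < L) (g_gt0 : 0 < g) (Z_gt0 : 0 < Z).

Let Y := Z ^ g.
Let X := Z ^ g.+1.

(** The base-[Z] digits of [x], lowest first, are the values of the [g.+1] groups of window [e]:
    [x %% Z ^ g] keeps the first [g] and [x %/ Z] the last [g]. Vertex [r] of layer [a] has the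
    number [a * Z ^ g + r]. *)
Definition edge_of (e x : nat) : nat * nat :=
  (e * Z ^ g + x %% Z ^ g, (e.+1 %% L) * Z ^ g + x %/ Z).

Definition layer (e x0 : nat) : seq (nat * nat) :=
  [seq edge_of e x | x <- iota 0 x0 & ok e x].

Definition layers (e0 : nat) : seq (nat * nat) :=
  flatten [seq layer e (Z ^ g.+1) | e <- iota 0 e0].

Definition star (k : nat) : seq (nat * nat) :=
  [seq (L * Z ^ g, L * Z ^ g + i.+1) | i <- iota 0 k].

(* The star keeps the number of edges above the threshold [M0] from which on the
   running time of the cycle algorithm is bounded. *)
Definition edge_list : seq (nat * nat) := layers L ++ star M0.+1.

Definition window (u : nat -> nat) (e : nat) : nat :=
  from_digits Z g.+1 (fun i => u ((e + i) %% L)).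

Let Y_gt0 : 0 < Y. Proof. by rewrite expn_gt0 Z_gt0. Qed.
Let XE : X = Z * Y. Proof. by rewrite /X expnS. Qed.

Lemma layerS e x : layer e x.+1 = layer e x ++ (if ok e x then [:: edge_of e x] else [::]).
Proof. by rewrite /layer -[x.+1]addn1 iotaD filter_cat map_cat /= add0n; case: ifP. Qed.

Lemma layersS e : layers e.+1 = layers e ++ layer e (Z ^ g.+1).
Proof. by rewrite /layers -[e.+1]addn1 iotaD map_cat flatten_cat /= add0n cats0. Qed.

Lemma starS k : star k.+1 = rcons (star k) (L * Z ^ g, L * Z ^ g + k.+1).
Proof. by rewrite /star -[X in iota 0 X]addn1 iotaD map_cat /= add0n cats1. Qed.

Lemma mem_layers e0 ab : reflect
  (exists e x, [/\ e < e0, x < X, ok e x & ab = edge_of e x]) (ab \in layers e0).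
Proof.
apply: (iffP flatten_mapP) => [[e]|[e [x [lt_e lt_x okx ->]]]].
  rewrite mem_iota => /andP[_ lt_e] /mapP[x]; rewrite mem_filter mem_iota.
  by move=> /and3P[okx _ lt_x] ->; exists e, x.
exists e; first by rewrite mem_iota.
by apply: map_f; rewrite mem_filter mem_iota okx.
Qed.

Let edge_mod e x : (e * Y + x %% Y) %% Y = x %% Y.
Proof. by rewrite modnMDl modn_mod. Qed.

Let edge_div e x : (e * Y + x %% Y) %/ Y = e.
Proof. by rewrite divnMDl // divn_small ?addn0 // ltn_pmod. Qed.

Let divX_lt x : x < X -> x %/ Z < Y.
Proof. by rewrite ltn_divLR // mulnC -XE. Qed.

Let modYZ x : x %% Y %% Z = x %% Z.
Proof. by rewrite modn_dvdm // /Y -(prednK g_gt0) expnS dvdn_mulr. Qed.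

(** The tail gives the layer and, as [g > 0], the lowest digit of [x]; the head gives all the other
    digits. *)
Let edge_of_inj e x e' x' : x < X -> x' < X -> edge_of e x = edge_of e' x' ->
  e = e' /\ x = x'.
Proof.
move=> lt_x lt_x' [eq1 eq2].
have ee : e = e' by rewrite -(edge_div e x) eq1 edge_div.
split => //; rewrite ee in eq2; move/eqP: eq2; rewrite eqn_add2l => /eqP eq2.
rewrite (divn_eq x Z) (divn_eq x' Z) eq2; congr (_ + _).
by rewrite -(modYZ x) -(edge_mod e) eq1 edge_mod modYZ.
Qed.

Let edge_of_lt e x : e < L -> x < X ->
  (edge_of e x).1 < L * Y /\ (edge_of e x).2 < L * Y.
Proof.
move=> lt_e lt_x /=.
have A a r : a < L -> r < Y -> a * Y + r < L * Y.
  move=> lt_a lt_r; have : a.+1 * Y <= L * Y by rewrite leq_mul2r lt_a orbT.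
  by rewrite mulSn; lia.
by split; apply: A; rewrite ?ltn_pmod ?divX_lt //; lia.
Qed.

Lemma uniq_edge_list : uniq edge_list.
Proof.
rewrite cat_uniq; apply/and3P; split.
- have : forall e0, uniq (layers e0); last exact.
  elim=> // e IH; rewrite layersS cat_uniq IH /=.
  apply/andP; split.
    apply/hasPn => ab /mapP[x]; rewrite mem_filter mem_iota => /and3P[_ _ lt_x] ->.
    apply/mem_layers => -[e' [x' [lt_e' lt_x' _ /(edge_of_inj lt_x lt_x')]]].
    by case=> ee _; rewrite ee ltnn in lt_e'.
  rewrite map_inj_in_uniq ?filter_uniq ?iota_uniq // => x x'.
  rewrite !mem_filter !mem_iota => /and3P[_ _ lt_x] /and3P[_ _ lt_x'].
  by case/(edge_of_inj lt_x lt_x').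
- apply/hasPn => _ /mapP[i _ ->]; apply/mem_layers => -[e [x [lt_e lt_x _ E]]].
  by have [] := edge_of_lt lt_e lt_x; rewrite -E /= ltnn.
- by rewrite map_inj_in_uniq ?iota_uniq // => i j _ _ [] /eqP; rewrite eqn_add2l eqSS => /eqP.
Qed.

Lemma edge_list_bounds :
  all (fun e => [&& e.1 < L * Y + M0.+2, e.2 < L * Y + M0.+2 & e.1 != e.2]) edge_list.
Proof.
rewrite all_cat; apply/andP; split; apply/allP => ab.
  move=> /mem_layers[e [x [lt_e lt_x _ ->]]].
  have [a b] := edge_of_lt lt_e lt_x; apply/and3P; split; try by lia.
  apply/eqP => /= E.
  have : e.+1 %% L = e.
    rewrite -[RHS](edge_div e x) E divnMDl // divn_small ?addn0 //; exact: divX_lt.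
  move: lt_e; rewrite leq_eqVlt => /orP[/eqP eL|lt_e]; first by rewrite eL modnn; lia.
  by rewrite modn_small //; lia.
by move=> /mapP[i]; rewrite mem_iota => /andP[_ lt_i] -> /=; rewrite -/Y; lia.
Qed.

Lemma size_layers e : size (layers e) <= e * X.
Proof.
elim: e => // e IH; rewrite layersS size_cat mulSn addnC leq_add //.
by rewrite size_map size_filter (leq_trans (count_size _ _)) // size_iota.
Qed.

Lemma size_edge_list : M0 < size edge_list <= L * X + M0.+1.
Proof.
by rewrite size_cat [size (star _)]size_map size_iota; have := size_layers L; lia.
Qed.

Lemma window_lt u e : (forall i, u i < Z) -> window u e < X.
Proof. by move=> lt_u; apply: from_digits_lt. Qed.

Lemma window_step u e : (forall i, u i < Z) ->
  window u (e.+1 %% L) %% Y = window u e %/ Z.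
Proof.
move=> lt_u; rewrite /window from_digits_mod_exp // from_digits_div //.
by apply: eq_from_digits => i _; rewrite modnDml addSnnS.
Qed.

Lemma cycle_of_window u : (forall i, u i < Z) -> (forall e, e < L -> ok e (window u e)) ->
  exists c, [/\ size c = L, uniq c & cycle (fun a b => (a, b) \in edge_list) c].
Proof.
move=> lt_u ok_u; exists (mkseq (fun e => e * Y + window u e %% Y) L); split.
- by rewrite size_mkseq.
- rewrite map_inj_in_uniq ?iota_uniq // => e e' _ _ E.
  by rewrite -(edge_div e (window u e)) E edge_div.
apply/(cycle_nth _ 0); rewrite size_mkseq => e lt_e.
rewrite !nth_mkseq ?ltn_pmod ?(ltnW L_gt1) // mem_cat; apply/orP; left.
apply/mem_layers; exists e, (window u e); split; rewrite ?window_lt ?ok_u //.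
by rewrite window_step.
Qed.

(** Each edge of the cycle leads to the next layer, so after a rotation vertex [e] lies in layer
    [e]. Labels of consecutive edges overlap in [g] digits; hence digit [i] of the label at [e] is
    the lowest digit of the label at [e + i], and the lowest digits form the assignment. *)
Lemma window_of_cycle c :
  size c = L -> cycle (fun a b => (a, b) \in edge_list) c ->
  exists2 u, forall i, u i < Z & forall e, e < L -> ok e (window u e).
Proof.
move=> sz_c /(cycle_nth _ 0); rewrite sz_c => cc.
have L_gt0 : 0 < L by lia.
pose v i := nth 0 c (i %% L).
have vE i : (v i, v i.+1) \in edge_list.
  by have := cc (i %% L) (ltn_pmod _ L_gt0); rewrite /v -addn1 modnDml addn1.
have {}vE i : exists x, [/\ v i %/ Y < L, x < X, ok (v i %/ Y) x,
    v i %% Y = x %% Y & v i.+1 = ((v i %/ Y).+1 %% L) * Y + x %/ Z].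
  have := vE i; rewrite mem_cat => /orP[/mem_layers[e [x [lt_e lt_x okx []]]]|].
    rewrite -/Y => -> ->; exists x.
    by rewrite edge_div edge_mod.
  (* A star edge ends in a leaf, from which no edge leads on. *)
  move=> /mapP[j _ [_ E]]; have := vE i.+1; rewrite E mem_cat => /orP[].
    move=> /mem_layers[e [x [lt_e lt_x okx []]]] E' _.
    have [] := edge_of_lt lt_e lt_x; rewrite /= -E'; rewrite -/Y; lia.
  by move=> /mapP[k _ [E' _]]; lia.
have lay i : v i %/ Y = (v 0 %/ Y + i) %% L.
  elim: i => [|i IH]; first by have [x [lt_L _ _ _ _]] := vE 0; rewrite addn0 modn_small.
  have [x [_ lt_x _ _ ->]] := vE i; rewrite divnMDl // (divn_small (divX_lt lt_x)) addn0.
  by rewrite IH -[(_ %% L).+1]addn1 modnDml addn1 addnS.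
have lt0 : v 0 %/ Y < L by have [x []] := vE 0.
(* The rotation that puts [w e] into layer [e %% L]. *)
pose w e := v (e + (L - v 0 %/ Y)).
have lw e : w e %/ Y = e %% L.
  by rewrite /w lay (_ : _ + _ = e + L) ?modnDr //; lia.
have wmod e : w (e %% L) = w e by rewrite /w /v modnDml.
(* The label of the edge out of [w e], recovered from its ends: lowest digit from the tail, the
   other digits from the head. *)
pose x e := w e %% Y %% Z + Z * (w e.+1 %% Y).
have xP e : [/\ x e < X, ok (e %% L) (x e), w e %% Y = x e %% Y & w e.+1 %% Y = x e %/ Z].
  have [y [_ lt_y]] := vE (e + (L - v 0 %/ Y)).
  rewrite -/(w e) -addSn -/(w e.+1) lw => oky yY wS.
  have wSY : w e.+1 %% Y = y %/ Z by rewrite wS modnMDl modn_small // divX_lt.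
  have -> : x e = y by rewrite /x yY modYZ wSY addnC mulnC -divn_eq.
  by [].
have xmod e : x (e %% L) = x e.
  have wS : w (e %% L).+1 = w e.+1.
    by rewrite -[LHS]wmod -[(e %% L).+1]addn1 modnDml addn1 wmod.
  by rewrite /x wmod wS.
have dig i e : i <= g -> digit Z i (x e) = x (e + i) %% Z.
  elim: i e => [|i IH] e le_i; first by rewrite digit0 addn0.
  have [_ _ _ wS] := xP e; have [_ _ wE _] := xP e.+1.
  by rewrite digitS -wS wE digit_modn // IH ?(ltnW le_i) // addSnnS.
exists (fun e => x e %% Z) => [i|e lt_e]; first by rewrite ltn_pmod.
have -> : window (fun e => x e %% Z) e = x e.
  have [lt_x _ _ _] := xP e; rewrite -[RHS](from_digits_digit lt_x).
  by apply: eq_from_digits => i lt_i; rewrite dig // xmod.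
by have [_] := xP e; rewrite modn_small.
Qed.

End Layered.

(** * Windows of variables *)

(* The variables [0 .. L * b - 1] are split cyclically into [L] groups of [b]; the
   window of layer [e] consists of the [g + 1] groups from group [e] on, and [wpos]
   is the position of a variable counted from the start of that window. *)
Definition wpos (L b e v : nat) : nat := (v + (L - e) * b) %% (L * b).
Definition in_window (L g b e v : nat) : bool := wpos L b e v < g.+1 * b.
Definition abit (b : nat) (u : nat -> nat) (v : nat) : nat := digit 2 (v %% b) (u (v %/ b)).

Lemma modn_block A L b r : r < b -> (A * b + r) %% (L * b) = A %% L * b + r.
Proof.
move=> lt_r; case: (posnP L) => [->|L_gt0]; first by rewrite mul0n !modn0.
rewrite [in LHS](divn_eq A L) mulnDl -mulnA -addnA modnMDl modn_small //.
have : (A %% L).+1 * b <= L * b by rewrite leq_mul2r ltn_pmod ?orbT.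
by rewrite mulSn; lia.
Qed.

Lemma digit_block b c r N : r < b -> digit 2 (c * b + r) N = digit 2 r (digit (2 ^ b) c N).
Proof.
by move=> lt_r; rewrite [digit (2 ^ b) c N]/digit digit_modn // /digit expnD divnMA mulnC expnM.
Qed.

Lemma wposE L b e v : e <= L -> 0 < b ->
  wpos L b e v = (v %/ b + (L - e)) %% L * b + v %% b.
Proof.
move=> le_e b_gt0; rewrite /wpos {1}(divn_eq v b) addnAC -mulnDl modn_block //.
by rewrite ltn_pmod.
Qed.

Lemma in_windowE L g b e v : e <= L -> 0 < b ->
  in_window L g b e v = ((v %/ b + (L - e)) %% L <= g).
Proof.
move=> le_e b_gt0; rewrite /in_window wposE //.
move: (_ %% L) (v %% b) (ltn_pmod v b_gt0) => c r lt_r.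
by apply/idP/idP; nia.
Qed.

(** This is what lets an edge be tested locally: its label alone determines the values of the
    variables in its window. *)
Lemma abit_window L g b u e v : e < L -> 0 < b -> v < L * b -> (forall i, u i < 2 ^ b) ->
  in_window L g b e v -> digit 2 (wpos L b e v) (window L g (2 ^ b) u e) = abit b u v.
Proof.
move=> lt_e b_gt0 lt_v lt_u; rewrite in_windowE ?(ltnW lt_e) // => le_g.
rewrite wposE ?(ltnW lt_e) // digit_block ?ltn_pmod // /abit; congr digit.
rewrite /window digit_from_digits // modnDmr addnCA subnKC ?(ltnW lt_e) //.
by rewrite modnDr modn_small // ltn_divLR.
Qed.

Lemma abit_ex b (f : nat -> bool) : 0 < b ->
  exists2 u, forall i, u i < 2 ^ b & forall v, abit b u v = f v.
Proof.
move=> b_gt0; exists (fun i => from_digits 2 b (fun r => f (i * b + r))).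
  by move=> i; apply: from_digits_lt => j _; case: (f _).
move=> v; rewrite /abit digit_from_digits ?ltn_pmod // -?divn_eq //.
by move=> j _; case: (f _).
Qed.

(* Of the three cyclic gaps between the groups of three variables the longest is at
   least L / 3; the window starting right after it contains all three. *)
Lemma window_cover L g b v0 v1 v2 : 0 < b -> g < L -> 3 * (L - g) <= L + 2 ->
  v0 < L * b -> v1 < L * b -> v2 < L * b ->
  exists2 e, e < L & [&& in_window L g b e v0, in_window L g b e v1 & in_window L g b e v2].
Proof.
move=> b_gt0 lt_g ceilL lt0 lt1 lt2.
have modE a e : a < L -> e < L -> (a + (L - e)) %% L = if e <= a then a - e else a + (L - e).
  move=> lt_a lt_e; case: ifP => le_ea; last by rewrite modn_small; lia.
  by rewrite (_ : a + (L - e) = a - e + L) ?modnDr ?modn_small; lia.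
have q0 : v0 %/ b < L by rewrite ltn_divLR.
have q1 : v1 %/ b < L by rewrite ltn_divLR.
have q2 : v2 %/ b < L by rewrite ltn_divLR.
have inE e v : e < L -> v %/ b < L -> in_window L g b e v =
    ((if e <= v %/ b then v %/ b - e else v %/ b + (L - e)) <= g).
  by move=> lt_e lt_v; rewrite in_windowE ?(ltnW lt_e) // modE.
pose contains e := [&& in_window L g b e v0, in_window L g b e v1 & in_window L g b e v2].
(* The longest gap ends at the group of one of the three variables, which leaves three candidates;
   the cyclic order of the groups decides among them. *)
have [||] : [\/ contains (v0 %/ b), contains (v1 %/ b) | contains (v2 %/ b)].
- rewrite /contains !inE // {inE modE}; move: (v0 %/ b) (v1 %/ b) (v2 %/ b) q0 q1 q2 => a0 a1 a2 q0 q1 q2.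
  rewrite !leqnn; apply/or3P.
  case: (leqP a0 a1) => ?; case: (leqP a1 a0) => ?; case: (leqP a0 a2) => ?;
    case: (leqP a2 a0) => ?; case: (leqP a1 a2) => ?; case: (leqP a2 a1) => ?; lia.
- by exists (v0 %/ b).
- by exists (v1 %/ b).
- by exists (v2 %/ b).
Qed.

(** * Thresholds on the numbers of satisfied clauses *)

Section Weights.

Variables (L g b m : nat) (I : nat -> nat).

(** The offset 2 skips the numbers of variables and clauses at the head of the input. *)
Definition lit (j i : nat) : nat := I (2 + 3 * j + i).

Definition clause_in (e j : nat) : bool :=
  [&& in_window L g b e (lit j 0 %/ 2), in_window L g b e (lit j 1 %/ 2)
    & in_window L g b e (lit j 2 %/ 2)].

(** A clause may lie in several windows; the last one is chosen, so that it is charged once. The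
    default 0 is never reached for actual clauses when [e] is [L], by [clause_in_home]. *)
Fixpoint home (e j : nat) : nat :=
  if e is e'.+1 then (if clause_in e' j then e' else home e' j) else 0.

(** A literal code is twice the variable plus the sign, so the sum is odd exactly when the bit
    equals the sign. *)
Definition litsat (e x l : nat) : nat := (digit 2 (wpos L b e (l %/ 2)) x + l + 1) %% 2.

Definition hit (e x j : nat) : bool :=
  (home L j == e) &&
  (litsat e x (lit j 0) + litsat e x (lit j 1) + litsat e x (lit j 2) != 0).

Definition weight (e x j : nat) : nat := count (hit e x) (iota 0 j).

Definition agree (e x P k : nat) : bool :=
  all (fun v => in_window L g b e v ==> (digit 2 (wpos L b e v) x == digit 2 v P)) (iota 0 k).

Definition ok_edge (W k P e x : nat) : bool :=
  (digit m.+1 e W <= weight e x m) && agree e x P k.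

Definition digit_sum (W e : nat) : nat := \sum_(i < e) digit m.+1 i W.

Definition feasible (W k P : nat) (u : nat -> nat) : Prop :=
  [/\ forall i, u i < 2 ^ b,
      forall e, e < L -> digit m.+1 e W <= weight e (window L g (2 ^ b) u e) m
    & forall v, v < k -> abit b u v = digit 2 v P].

Hypotheses (b_gt0 : 0 < b) (g_lt : g < L) (ceilL : 3 * (L - g) <= L + 2).

(** Prescribed values are tested one window at a time. Nothing escapes the tests: [window_cover],
    applied to the same variable three times, shows that each variable lies in some window. *)
Lemma feasibleP W k P : k <= L * b ->
  (exists u, feasible W k P u) <->
  (exists2 u, forall i, u i < 2 ^ b & forall e, e < L -> ok_edge W k P e (window L g (2 ^ b) u e)).
Proof.
move=> le_k; split=> [[u [lt_u wu pu]]|[u lt_u ok_u]]; exists u => //.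
  move=> e lt_e; rewrite /ok_edge wu //=; apply/allP => v; rewrite mem_iota => /andP[_ lt_v].
  by apply/implyP => inw; rewrite abit_window // ?pu //; lia.
split => // [e /ok_u/andP[]//|v lt_v].
have lt_vL : v < L * b by lia.
have [e lt_e /and3P[inw _ _]] := window_cover b_gt0 g_lt ceilL lt_vL lt_vL lt_vL.
have /andP[_ /allP/(_ v)] := ok_u e lt_e.
by rewrite mem_iota lt_v inw /= => /(_ isT)/eqP; rewrite abit_window.
Qed.

Hypothesis lit_lt : forall j i, j < m -> i < 3 -> lit j i %/ 2 < L * b.

Lemma home_lt j : 0 < L -> home L j < L.
Proof.
move=> L_gt0; have : forall e, e <= L -> home e j < L; last by apply.
by elim=> //= e IH lt_e; case: ifP => // _; apply: IH; lia.
Qed.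

Lemma clause_in_home j : j < m -> clause_in (home L j) j.
Proof.
move=> lt_j; have [e lt_e] := window_cover b_gt0 g_lt ceilL (lit_lt lt_j (isT : 0 < 3))
  (lit_lt lt_j (isT : 1 < 3)) (lit_lt lt_j (isT : 2 < 3)).
rewrite -/(clause_in e j); elim: (L) lt_e => // k IH; rewrite ltnS leq_eqVlt /=.
move=> /orP[/eqP-> cl|lt_e cl]; first by rewrite cl.
by case: ifP => // _; apply: IH.
Qed.

Definition holds (f : nat -> nat) (j : nat) : bool :=
  has (fun i => f (lit j i %/ 2) == lit j i %% 2) [:: 0; 1; 2].

Lemma hit_window u e j : (forall i, u i < 2 ^ b) -> j < m ->
  hit e (window L g (2 ^ b) u e) j = (home L j == e) && holds (abit b u) j.
Proof.
move=> lt_u lt_j; rewrite /hit; case: eqP => //= <-.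
have lt_h : home L j < L by apply: home_lt; lia.
have /and3P[i0 i1 i2] := clause_in_home lt_j.
rewrite /litsat !abit_window ?lit_lt //; rewrite /holds /= orbF.
have b2 v : abit b u v < 2 by apply: digit_lt.
have P l : (abit b u (l %/ 2) + l + 1) %% 2 = (abit b u (l %/ 2) == l %% 2).
  by have := b2 (l %/ 2); case: eqP; lia.
by rewrite !P; do 3 case: (abit _ _ _ == _).
Qed.

(** Double counting: a satisfied clause contributes to its home window and to no other. *)
Lemma sum_weight u : (forall i, u i < 2 ^ b) ->
  \sum_(e < L) weight e (window L g (2 ^ b) u e) m = count (holds (abit b u)) (iota 0 m).
Proof.
move=> lt_u; rewrite -sum1_count.
transitivity (\sum_(e < L) \sum_(j <- iota 0 m)
    nat_of_bool ((home L j == e) && holds (abit b u) j)).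
  apply: eq_bigr => e _; rewrite /weight -sum1_count big_mkcond /=.
  rewrite big_seq [RHS]big_seq; apply: eq_bigr => j; rewrite mem_iota => /andP[_ lt_j].
  by rewrite hit_window //; case: (_ && _).
rewrite exchange_big [RHS]big_mkcond /=; apply: eq_bigr => j _.
have lt_h : home L j < L by apply: home_lt; lia.
rewrite (bigD1 (Ordinal lt_h)) //= eqxx big1 ?addn0; first by case: (holds _ _).
by move=> e ne; case: eqP => //= he; move: ne; rewrite -val_eqE /= he eqxx.
Qed.

Lemma weight_le e x j : weight e x j <= j.
Proof. by rewrite -{2}(size_iota 0 j) count_size. Qed.

Lemma feasible_dominates W k P u : feasible W k P u ->
  digit_sum W L <= count (holds (abit b u)) (iota 0 m).
Proof.
by move=> [lt_u wu _]; rewrite -sum_weight //; apply: leq_sum => e _; apply: wu.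
Qed.

(** Take the actual weights as thresholds. With [feasible_dominates], the largest digit sum of a
    feasible guess is thus the optimum. *)
Lemma feasible_exact u : (forall i, u i < 2 ^ b) -> exists2 W, W < m.+1 ^ L &
  feasible W 0 0 u /\ digit_sum W L = count (holds (abit b u)) (iota 0 m).
Proof.
move=> lt_u; pose f e := weight e (window L g (2 ^ b) u e) m.
have lt_f e : f e < m.+1 by rewrite ltnS weight_le.
exists (from_digits m.+1 L f); first exact: from_digits_lt.
have dE e : e < L -> digit m.+1 e (from_digits m.+1 L f) = f e.
  by move=> lt_e; rewrite digit_from_digits.
split; last by rewrite -sum_weight //; apply: eq_bigr => e _; rewrite dE.
by split => // e lt_e; rewrite dE.
Qed.

End Weights.

(** * The search, with the cycle queries as an oracle *)

Section Search.

Variables (L g b n m : nat) (I : nat -> nat) (query : nat -> nat -> nat -> bool).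

(** The initial value [(0, 0)] is itself a feasible guess, as every assignment meets thresholds 0;
    the result is therefore feasible in every case. *)
Fixpoint search_best (W : nat) : nat * nat :=
  if W is W'.+1 then
    let r := search_best W' in
    if query W' 0 0 && (r.1 < digit_sum m W' L) then (digit_sum m W' L, W') else r
  else (0, 0).

Fixpoint fix_bits (W v : nat) : nat :=
  if v is v'.+1 then
    let P := fix_bits W v' in if query W v'.+1 (P + 2 ^ v') then P + 2 ^ v' else P
  else 0.

Lemma search_best2_lt W0 : (search_best W0).2 <= W0.
Proof. by elim: W0 => //= W0 IH; case: ifP => _ //=; lia. Qed.

Lemma fix_bits_lt W v : fix_bits W v < 2 ^ v.
Proof. by elim: v => //= v IH; rewrite expnS; case: ifP => _; lia. Qed.

Lemma digit2_add v P i : P < 2 ^ v -> digit 2 i (P + 2 ^ v) = if i == v then 1 else digit 2 i P.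
Proof.
move=> lt_P; case: (ltngtP i v) => [lt_i|lt_v|->].
- by rewrite -[LHS](digit_modn 2 (P + 2 ^ v) lt_i) modnDr digit_modn.
- have le2 : 2 ^ v.+1 <= 2 ^ i by rewrite leq_exp2l.
  by rewrite /digit !divn_small //; move: le2; rewrite expnS; lia.
- rewrite /digit divnDr // divnn expn_gt0 divn_small //.
Qed.

Lemma digit2_small v P : P < 2 ^ v -> digit 2 v P = 0.
Proof. by move=> lt_P; rewrite /digit divn_small // mod0n. Qed.

Hypotheses (b_gt0 : 0 < b) (g_lt : g < L) (ceilL : 3 * (L - g) <= L + 2).
Hypothesis n_le : n <= L * b.
Hypothesis lit_lt : forall j i, j < m -> i < 3 -> lit I j i %/ 2 < n.
Hypothesis queryP : forall W k P, k <= n ->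
  query W k P <-> exists u, feasible L g b m I W k P u.

Let lit_ltL j i : j < m -> i < 3 -> lit I j i %/ 2 < L * b.
Proof. by move=> lt_j lt_i; apply: leq_trans (lit_lt lt_j lt_i) n_le. Qed.

Lemma search_bestP W0 : let r := search_best W0 in
  [/\ exists u, feasible L g b m I r.2 0 0 u, r.1 = digit_sum m r.2 L
    & forall W, W < W0 -> query W 0 0 -> digit_sum m W L <= r.1].
Proof.
elim: W0 => [|W0 [fe eq1 best]] /=.
  have lt_u : forall i, (fun _ : nat => 0) i < 2 ^ b by move=> _; rewrite expn_gt0.
  split => //; last by rewrite /digit_sum big1 // => i _; rewrite /digit div0n mod0n.
  by exists (fun=> 0); split => // e _; rewrite /digit div0n mod0n.
case: ifP => [/andP[q lt_d]|ne]; split => //=.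
- by apply/queryP.
- by move=> W; rewrite ltnS leq_eqVlt => /orP[/eqP->//|/best{}best /best le]; lia.
- move=> W; rewrite ltnS leq_eqVlt => /orP[/eqP->|]; last exact: best.
  by move=> q; move: ne; rewrite q /= => /negbT; rewrite -leqNgt.
Qed.

Lemma fix_bitsP W v : v <= n -> (exists u, feasible L g b m I W 0 0 u) ->
  exists u, feasible L g b m I W v (fix_bits W v) u.
Proof.
move=> le_v fe; elim: v le_v => [|v IH] lt_v //=.
case: ifP => [q|nq]; first exact/queryP.
have [u [lt_u wu pu]] := IH (ltnW lt_v); exists u; split => // i; rewrite ltnS leq_eqVlt.
have lt_P := fix_bits_lt W v.
move=> /orP[/eqP->|]; last exact: pu.
(* The assignment already at hand must have bit [v] equal to 0, since otherwise it would itself make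
   the rejected query succeed. *)
rewrite digit2_small //; apply/eqP; apply: contraFT nq => nz; apply/queryP => //.
exists u; split => // j; rewrite digit2_add // ltnS leq_eqVlt.
case: eqP => [->|_] /=; last exact: pu.
by move=> _; have := @digit_lt 2 (v %% b) (u (v %/ b)) isT; rewrite -/(abit b u v); lia.
Qed.

(** The tight guess for [f] is among those tried, so its sum is at most the best one; and the final
    assignment still meets the best guess, so it satisfies at least that many clauses. *)
Theorem search_optimal f : (forall v, v < n -> f v < 2) ->
  let P := fix_bits (search_best (m.+1 ^ L)).2 n in
  count (holds I f) (iota 0 m) <= count (holds I (digit 2 ^~ P)) (iota 0 m).
Proof.
move=> lt_f; cbv zeta.
(* Variables from [n] to [L * b - 1] only fill up the groups and occur in no clause. *)
have holds_ext f1 f2 : (forall v, v < n -> f1 v = f2 v) ->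
    count (holds I f1) (iota 0 m) = count (holds I f2) (iota 0 m).
  move=> f12; apply: eq_in_count => j; rewrite mem_iota => /andP[_ lt_j].
  by apply: eq_in_has => i; rewrite !inE => /or3P[]/eqP->; rewrite f12 // lit_lt.
have [u0 lt_u0 u0E] := @abit_ex b (fun v => f v == 1) b_gt0.
have [fe eq1 best] := search_bestP (m.+1 ^ L).
have [u fu] := fix_bitsP (leqnn n) fe.
rewrite -(@holds_ext (abit b u) (digit 2 ^~ _)); last by case: fu.
rewrite (@holds_ext f (abit b u0)); last first.
  by move=> v /lt_f; rewrite u0E; case: (f v) => [|[|]].
have [W lt_W [fW <-]] := feasible_exact b_gt0 g_lt ceilL lit_ltL lt_u0.
apply: leq_trans (feasible_dominates b_gt0 g_lt ceilL lit_ltL fu).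
by rewrite -eq1; apply: best => //; apply/queryP => //; exists u0.
Qed.

End Search.

(** * Encoding of formulas *)

Section Formula.

Variable F : cnf3.

Let codes (cls : seq (3.-tuple ('I_(nvars F) * bool))) :=
  flatten [seq [seq literal_code l | l <- tval cl] | cl <- cls].

Lemma size_codes cls : size (codes cls) = 3 * size cls.
Proof. by elim: cls => //= cl cls IH; rewrite size_cat size_map size_tuple IH; lia. Qed.

Lemma lit_codes j i : lit (nth 0 (cnf3_input F)) j i = nth 0 (codes (clauses F)) (3 * j + i).
Proof. by []. Qed.

Lemma literal_code_lt (l : 'I_(nvars F) * bool) : literal_code l < 2 * nvars F.
Proof. by rewrite /literal_code; case: l => [v []] /=; have := ltn_ord v; lia. Qed.

Lemma codes_lt cls i : i < 3 * size cls -> nth 0 (codes cls) i < 2 * nvars F.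
Proof.
move=> lt_i; have : nth 0 (codes cls) i \in codes cls by rewrite mem_nth // size_codes.
by move=> /flatten_mapP[cl _ /mapP[l _ ->]]; apply: literal_code_lt.
Qed.

Lemma cnf3_lit_lt j i : j < nclauses F -> i < 3 ->
  lit (nth 0 (cnf3_input F)) j i %/ 2 < nvars F.
Proof.
move=> lt_j lt_i; rewrite lit_codes.
have : nth 0 (codes (clauses F)) (3 * j + i) < 2 * nvars F.
  by apply: codes_lt; move: lt_j; rewrite /nclauses; lia.
lia.
Qed.

Lemma num_sat_holds (a : assignment F) (f : nat -> nat) :
  (forall i : 'I_(nvars F), f i = a i) ->
  num_sat a = count (holds (nth 0 (cnf3_input F)) f) (iota 0 (nclauses F)).
Proof.
move=> fa; rewrite /num_sat /nclauses.
have fl (l : 'I_(nvars F) * bool) :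
    (f (literal_code l %/ 2) == literal_code l %% 2) = (a l.1 == l.2).
  have -> : literal_code l %/ 2 = l.1 by rewrite /literal_code; case: l => [v []] /=; lia.
  have -> : literal_code l %% 2 = l.2 by rewrite /literal_code; case: l => [v []] /=; lia.
  by rewrite fa; case: (a _) l.2 => [] [].
have hE j : holds (nth 0 (cnf3_input F)) f j =
    has (fun i => f (nth 0 (codes (clauses F)) (3 * j + i) %/ 2) ==
                  nth 0 (codes (clauses F)) (3 * j + i) %% 2) [:: 0; 1; 2] by [].
rewrite (eq_count hE); elim: (clauses F) => //= cl cls IH.
rewrite (iotaDl 1 0) count_map IH; congr (_ + _).
  case: cl => [[|l0 [|l1 [|l2 [|]]]] sz] //=.
  by rewrite !fl.
apply: eq_count => j; have e i : (0 + j + 2 * (1 + j))%coq_nat + i = (3 * j + i).+2 by lia.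
by case: cl => [[|l0 [|l1 [|l2 [|]]]] sz] //; rewrite /preim /= !e.
Qed.

End Formula.

(** * The reduction as a program *)

(* [vW], [vK], [vP] are the arguments of a query: the bounds as the digits of [vW] in
   base [m + 1], and the values [vP], one per bit, of the first [vK] variables.  The
   counter [vCUR] numbers the queries; [vRES] and [vTOT] receive the answer and the sum
   of the bounds.  Numbers from [vPC] on belong to the interpreted program. *)
Notation vN := 0 (only parsing).
Notation vM := 1 (only parsing).
Notation vB := 2 (only parsing).
Notation vX := 3 (only parsing).
Notation vY := 4 (only parsing).
Notation vZ := 5 (only parsing).
Notation vW := 8 (only parsing).
Notation vK := 9 (only parsing).
Notation vP := 10 (only parsing).
Notation vD := 11 (only parsing).
Notation vTOT := 12 (only parsing).
Notation vCNT := 13 (only parsing).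
Notation vE := 14 (only parsing).
Notation vTH := 15 (only parsing).
Notation vXX := 16 (only parsing).
Notation vS := 17 (only parsing).
Notation vJ := 18 (only parsing).
Notation vOK := 19 (only parsing).
Notation vV := 20 (only parsing).
Notation vRES := 21 (only parsing).
Notation vBEST := 22 (only parsing).
Notation vBESTW := 23 (only parsing).
Notation vQ := 24 (only parsing).
Notation vNW := 25 (only parsing).
Notation vI := 26 (only parsing).

Section Program.

Variables (L g M0 : nat) (p : program).

Definition ewpos (e v : expr) :=
  emod (eadd v (emul (esub (EC L) e) (EV vB))) (emul (EC L) (EV vB)).
Definition einw (e v : expr) := esub (emul (EC g.+1) (EV vB)) (ewpos e v).
Definition ebit (x i : expr) := emod (EO OShr x i) (EC 2).
Definition elit (i : nat) := EL (eadd (eadd (EC 2) (emul (EC 3) (EV vJ))) (EC i)).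
Definition elitsat (l : expr) :=
  emod (eadd (eadd (ebit (EV vXX) (ewpos (EV vE) (ediv l (EC 2)))) l) (EC 1)) (EC 2).
(** The home table sits right behind the formula, with one cell per clause; the memory of the
    interpreted program starts behind it, at [2 + 4 * m]. *)
Definition ehome := eadd (eadd (EC 2) (emul (EC 3) (EV vM))) (EV vJ).

(** Run for increasing windows, each overwriting the entry, this leaves the last window that
    contains the clause, in agreement with [home]. *)
Definition home_body : cmd :=
  Ite (emul (emul (einw (EV vE) (ediv (elit 0) (EC 2))) (einw (EV vE) (ediv (elit 1) (EC 2))))
        (einw (EV vE) (ediv (elit 2) (EC 2))))
    (Sto ehome (EV vE)) Skip.

Definition setup : cmd :=
  Seq (Asg vN (EL (EC 0)))
  (Seq (Asg vM (EL (EC 1)))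
  (Seq (Asg vB (eadd (ediv (EV vN) (EC L)) (EC 1)))
  (Seq (Asg vZ (EO OShl (EC 1) (EV vB)))
  (Seq (Asg vY (EO OShl (EC 1) (emul (EV vB) (EC g))))
  (Seq (Asg vX (EO OShl (EC 1) (emul (EV vB) (EC g.+1))))
  (Seq (Asg vBASE (eadd (EC 2) (emul (EC 4) (EV vM))))
  (Seq (For vE (EC L) (For vJ (EV vM) home_body))
  (Seq (Asg vNW (EC 1))
       (For vE (EC L) (Asg vNW (emul (EV vNW) (eadd (EV vM) (EC 1))))))))))))).

Definition weight_body : cmd :=
  Ite (emul (eeq (EL ehome) (EV vE))
        (eadd (eadd (elitsat (elit 0)) (elitsat (elit 1))) (elitsat (elit 2))))
    (Asg vS (eadd (EV vS) (EC 1))) Skip.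

Definition agree_body : cmd :=
  Ite (emul (einw (EV vE) (EV vV))
        (eadd (esub (ebit (EV vXX) (ewpos (EV vE) (EV vV))) (ebit (EV vP) (EV vV)))
              (esub (ebit (EV vP) (EV vV)) (ebit (EV vXX) (ewpos (EV vE) (EV vV))))))
    (Asg vOK (EC 0)) Skip.

Definition push (a b : expr) : cmd :=
  Seq (vstore (eadd (EC 2) (emul (EC 2) (EV vCNT))) a)
  (Seq (vstore (eadd (EC 3) (emul (EC 2) (EV vCNT))) b)
       (Asg vCNT (eadd (EV vCNT) (EC 1)))).

Definition edge_body : cmd :=
  Seq (Asg vS (EC 0))
  (Seq (For vJ (EV vM) weight_body)
  (Seq (Asg vOK (esub (EC 1) (esub (EV vTH) (EV vS))))
  (Seq (For vV (EV vK) agree_body)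
       (Ite (EV vOK)
          (push (eadd (emul (EV vE) (EV vY)) (emod (EV vXX) (EV vY)))
                (eadd (emul (emod (eadd (EV vE) (EC 1)) (EC L)) (EV vY)) (ediv (EV vXX) (EV vZ))))
          Skip)))).

Definition layer_body : cmd :=
  Seq (Asg vTH (emod (ediv (EV vW) (EV vD)) (eadd (EV vM) (EC 1))))
  (Seq (Asg vD (emul (EV vD) (eadd (EV vM) (EC 1))))
  (Seq (Asg vTOT (eadd (EV vTOT) (EV vTH)))
       (For vXX (EV vX) edge_body))).

Definition star_body : cmd :=
  push (emul (EC L) (EV vY)) (eadd (emul (EC L) (EV vY)) (eadd (EV vV) (EC 1))).

(** The two header cells are written last because the number of edges is known only then. [vD] runs
    through the powers of [m + 1] to extract the thresholds from [vW]. *)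
Definition build : cmd :=
  Seq (Asg vCUR (eadd (EV vCUR) (EC 1)))
  (Seq (Asg vCNT (EC 0))
  (Seq (Asg vD (EC 1))
  (Seq (Asg vTOT (EC 0))
  (Seq (For vE (EC L) layer_body)
  (Seq (For vV (EC M0.+1) star_body)
  (Seq (vstore (EC 0) (eadd (emul (EC L) (EV vY)) (EC M0.+2)))
       (vstore (EC 1) (EV vCNT)))))))).

Definition run_query : cmd := Seq build (Seq (call p) (Asg vRES (vload (EC 0)))).

Definition best_body : cmd :=
  Seq run_query
      (Ite (emul (EV vRES) (esub (EV vTOT) (EV vBEST)))
         (Seq (Asg vBEST (EV vTOT)) (Asg vBESTW (EV vW))) Skip).

Definition fix_body : cmd :=
  Seq (Asg vK (eadd (EV vI) (EC 1)))
  (Seq (Asg vP (eadd (EV vP) (EV vQ)))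
  (Seq run_query
  (Seq (Ite (EV vRES) Skip (Asg vP (esub (EV vP) (EV vQ))))
       (Asg vQ (emul (EV vQ) (EC 2)))))).

(** The output overwrites the input cells; this is harmless because the whole assignment is by then
    in the single variable [vP]. *)
Definition max3sat_cmd : cmd :=
  Seq setup
  (Seq (For vW (EV vNW) best_body)
  (Seq (Asg vW (EV vBESTW))
  (Seq (Asg vQ (EC 1))
  (Seq (For vI (EV vN) fix_body)
       (For vI (EV vN) (Sto (EV vI) (ebit (EV vP) (EV vI)))))))).

Lemma wf_max3sat_cmd : wf max3sat_cmd.
Proof.
have wc := wf_call p.
by rewrite /max3sat_cmd /best_body /fix_body /run_query; move: (call p) wc => c /= ->.
Qed.
End Program.

(** * Correctness and cost of the reduction program *)

Definition flat (E : seq (nat * nat)) : seq nat := flatten [seq [:: e.1; e.2] | e <- E].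

Lemma size_flat E : size (flat E) = 2 * size E.
Proof. by elim: E => //= e E IH; rewrite IH; lia. Qed.

Lemma nth_flat_rcons E x y a :
  nth 0 [:: 0, 0 & flat (rcons E (x, y))] a =
  upd (upd (nth 0 [:: 0, 0 & flat E]) (2 + 2 * size E) x) (3 + 2 * size E) y a.
Proof.
rewrite /flat map_rcons flatten_rcons /= -/(flat E).
have -> : [:: 0, 0 & flat E ++ [:: x; y]] = [:: 0, 0 & flat E] ++ [:: x; y] by [].
have : size [:: 0, 0 & flat E] = 2 + 2 * size E by rewrite /= size_flat.
move: [:: 0, 0 & flat E] => l sz; rewrite nth_cat sz /upd.
case: (ltngtP a (2 + 2 * size E)) => [lt_a|lt_a|->].
- by rewrite ifF //; lia.
- case: eqP => [->|ne]; first by rewrite (_ : _ - _ = 1) //; lia.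
  by rewrite (nth_default 0 (s := l)) ?sz ?nth_default //=; lia.
- by rewrite subnn ifF //; lia.
Qed.

Lemma low_eq_trans base M1 M2 M3 : low_eq base M1 M2 -> low_eq base M2 M3 -> low_eq base M1 M3.
Proof. by move=> l12 l23 a lt_a; rewrite l23 // l12. Qed.

Section Correctness.

Variables (L g M0 : nat) (p : program) (h n m b : nat) (I : nat -> nat).

Let Z := 2 ^ b.
Let Y := Z ^ g.
Let X := Z ^ g.+1.
Let base := 2 + 4 * m.

Hypotheses (L_gt1 : 1 < L) (g_gt0 : 0 < g) (g_lt : g < L) (b_gt0 : 0 < b).
Hypothesis bnd_search : m.+1 ^ L + n + 2 < 2 ^ h.
Hypothesis bnd_graph : L * X + L * Y + X + M0 + 10 < 2 ^ h.
Hypothesis bnd_formula : L * m + 4 * m + 10 < 2 ^ h.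
Hypothesis bnd_bits : 2 ^ n.+1 < 2 ^ h.
Hypotheses (bnd_size : size p < 2 ^ h) (bnd_jump : jump_bound p < 2 ^ h).

Let Z_gt0 : 0 < Z. Proof. by rewrite expn_gt0. Qed.
Let Y_gt0 : 0 < Y. Proof. by rewrite expn_gt0 Z_gt0. Qed.
Let X_gt0 : 0 < X. Proof. by rewrite expn_gt0 Z_gt0. Qed.
Let L_lt : L < 2 ^ h. Proof. by have := X_gt0; nia. Qed.

Record params (s : state) : Prop := Params {
  par_n : vars s vN = n;
  par_m : vars s vM = m;
  par_b : vars s vB = b;
  par_X : vars s vX = X;
  par_Y : vars s vY = Y;
  par_Z : vars s vZ = Z;
  par_base : vars s vBASE = base;
  par_input : forall a, a < 2 + 3 * m -> cells s a = I a }.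

Record static (s : state) : Prop := Static {
  static_params :> params s;
  static_home : forall j, j < m -> cells s (2 + 3 * m + j) = home L g b I L j }.

Lemma params_frame (P : pred nat) s s' : ~~ has P (iota 0 7) ->
  (forall v, ~~ P v -> vars s' v = vars s v) ->
  (forall a, a < 2 + 3 * m -> cells s' a = cells s a) -> params s -> params s'.
Proof.
move=> /hasPn nP fr lo [pn pm pb pX pY pZ pB pI].
have fr7 v : v < 7 -> vars s' v = vars s v by move=> lt_v; apply/fr/nP; rewrite mem_iota.
by split; rewrite ?fr7 // => a lt_a; rewrite lo // pI.
Qed.

Lemma static_frame (P : pred nat) s s' : ~~ has P (iota 0 7) ->
  (forall v, ~~ P v -> vars s' v = vars s v) -> low_eq base (cells s) (cells s') ->
  static s -> static s'.
Proof.
move=> nP fr lo [par hm]; split.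
  by apply: (params_frame nP fr) par => a lt_a; apply: lo; rewrite /base; lia.
by move=> j lt_j; rewrite lo ?hm // /base; lia.
Qed.

Lemma eval_lit s j i : params s -> vars s vJ = j -> j < m -> i < 3 ->
  eval (elit i) s = lit I j i.
Proof. by move=> par vj lt_j lt_i; rewrite /= vj par_input //; lia. Qed.

Lemma eval_wpos s e v : params s -> eval (ewpos L e v) s = wpos L b (eval e s) (eval v s).
Proof. by move=> par; rewrite /= par_b. Qed.

Lemma eval_inw s e v : params s ->
  (eval (einw L g e v) s != 0) = in_window L g b (eval e s) (eval v s).
Proof. by move=> par; rewrite /= par_b // -/(wpos _ _ _ _) -lt0n subn_gt0. Qed.

Lemma spec_home_inner e s T : params s -> vars s vE = e -> e < L ->
  (forall j, j < m -> cells s (2 + 3 * m + j) = home L g b I e j) -> 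
  (forall a, base <= a -> cells s a = 0) -> m * 110 + 10 <= T ->
  spec h (For vJ (EV vM) (home_body L g)) s T (fun s' =>
    [/\ params s', forall v, v != vJ -> vars s' v = vars s v,
        forall j, j < m -> cells s' (2 + 3 * m + j) = home L g b I e.+1 j
      & forall a, base <= a -> cells s' a = 0]).
Proof.
move=> par ve lt_e hm hi le_T.
apply: (@spec_for _ _ _ _ _ m _ 90 (pred1 vJ) (fun k s1 =>
  [/\ params s1,
      forall j, j < m -> cells s1 (2 + 3 * m + j) = home L g b I (if j < k then e.+1 else e) j
   & forall a, base <= a -> cells s1 a = 0])) => //=.
- lia.
- by move=> s1 fr; rewrite fr // par_m.
- by split => //; apply: (@params_frame (pred1 vJ) s) par => // v /negbTE; rewrite /= /upd => ->.
- move=> k s1 lt_k vk fr _ [par1 hm1 hi1]; rewrite -/(home_body L g).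
  have ve1 : vars s1 vE = e by rewrite fr.
  have vm1 := par_m par1.
  have bit2 : clause_in L g b I e k =
      (eval (emul (emul (einw L g (EV vE) (ediv (elit 0) (EC 2)))
                        (einw L g (EV vE) (ediv (elit 1) (EC 2))))
        (einw L g (EV vE) (ediv (elit 2) (EC 2)))) s1 != 0).
    have evM x y : eval (emul x y) s1 = eval x s1 * eval y s1 by [].
    have evD x : eval (ediv x (EC 2)) s1 = eval x s1 %/ 2 by [].
    have evE : eval (EV vE) s1 = e by [].
    rewrite !evM !muln_eq0 !negb_or !eval_inw // !evD !(eval_lit par1 vk) // evE.
    by rewrite -andbA.
  apply: spec_ite => //.
    rewrite -bit2 => cl; apply: spec_sto => //; first by rewrite /= ve1; lia.
    split => /=.
    + apply: (@params_frame (pred1 vJ) s1) par1 => // [v /negbTE|a lt_a] /=.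
        by rewrite /upd => ->.
      by rewrite /upd vm1 ifF //; lia.
    + move=> j lt_j; rewrite vm1 vk ve1 /upd eqn_add2l ltnS.
      case: (ltngtP j k) => [lt|gt|->] /=; last by rewrite cl.
        by rewrite hm1 // lt.
      by rewrite hm1 // ltnNge (ltnW gt).
    + by move=> a le_a; rewrite /upd vm1 vk ifF ?hi1 //; move: le_a; rewrite /base; lia.
  move=> /eqP; rewrite -[_ == _]negbK -bit2 => /negbTE ncl; apply: spec_skip; split => //.
  + by apply: (@params_frame (pred1 vJ) s1) par1 => // v /negbTE; rewrite /= /upd => ->.
  + move=> j lt_j; rewrite hm1 // ltnS.
    case: (ltngtP j k) => [lt|gt|->] //=; first by rewrite ncl.
- move=> s1 _ fr _ [par1 hm1 hi1]; split => //.
  by move=> j lt_j; rewrite hm1 // lt_j.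
- lia.
Qed.

Lemma spec_weight s e x T : static s -> vars s vE = e -> vars s vXX = x -> vars s vS = 0 ->
  m * 170 + 10 <= T ->
  spec h (For vJ (EV vM) (weight_body L)) s T (fun s' => vars s' vS = weight L g b I e x m).
Proof.
move=> st ve vx vs le_T.
apply: (@spec_for _ _ _ _ _ m _ 150 (fun v => v \in [:: vS; vJ])
  (fun k s1 => vars s1 vS = weight L g b I e x k)) => //.
- lia.
- by move=> s1 fr /=; rewrite fr // (par_m st).
- move=> k s1 lt_k vk fr /(_ isT) me wk.
  have st1 : static s1 by apply: (@static_frame (fun v => v \in [:: vS; vJ]) s) => //; rewrite me.
  have ve1 : vars s1 vE = e by rewrite fr.
  have vx1 : vars s1 vXX = x by rewrite fr.
  have evS i : i < 3 -> eval (elitsat L (elit i)) s1 = litsat L b e x (lit I k i).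
    move=> lt_i; rewrite -(eval_lit st1 vk lt_k lt_i) /litsat.
    by rewrite -[e in wpos L b e]ve1 -vx1 /elitsat /= (par_b st1).
  have evH : eval (emul (eeq (EL ehome) (EV vE))
        (eadd (eadd (elitsat L (elit 0)) (elitsat L (elit 1))) (elitsat L (elit 2)))) s1 != 0
      = hit L g b I e x k.
    have evM y z : eval (emul y z) s1 = eval y s1 * eval z s1 by [].
    have evA y z : eval (eadd y z) s1 = eval y s1 + eval z s1 by [].
    rewrite evM eval_eeq !evA !evS // muln_eq0 negb_or eqb0 negbK; congr ((_ == _) && _) => //.
    by rewrite /= vk (par_m st1) (static_home st1).
  have wS : weight L g b I e x k.+1 = weight L g b I e x k + hit L g b I e x k.
    by rewrite /weight -addn1 iotaD count_cat /= add0n addn0.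
  have le_w : weight L g b I e x k <= k by apply: weight_le.
  apply: spec_ite => //.
    rewrite evH => hk; apply: spec_asg => //; rewrite /= wk; first by lia.
    by rewrite /upd /= wS hk.
  move=> z; apply: spec_skip; rewrite /= /upd /= wS wk.
  by move: evH; rewrite z => <-; rewrite addn0.
- by rewrite /=; lia.
Qed.

Lemma spec_agree s e x P k T : static s -> vars s vE = e -> vars s vXX = x ->
  vars s vP = P -> vars s vK = k -> k <= n -> k * 90 + 10 <= T ->
  spec h (For vV (EV vK) (agree_body L g)) s T
    (fun s' => (vars s' vOK != 0) = (vars s vOK != 0) && agree L g b e x P k).
Proof.
move=> st ve vx vp vk le_k le_T.
apply: (@spec_for _ _ _ _ _ k _ 70 (fun v => v \in [:: vOK; vV])
  (fun k s1 => (vars s1 vOK != 0) = (vars s vOK != 0) && agree L g b e x P k)) => //.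
- lia.
- by move=> s1 fr /=; rewrite fr // vk.
- by rewrite /= /upd /= andbT.
- move=> i s1 lt_i vi fr /(_ isT) me oki.
  have st1 : static s1 by apply: (@static_frame (fun v => v \in [:: vOK; vV]) s) => //; rewrite me.
  have ve1 : vars s1 vE = e by rewrite fr.
  have vx1 : vars s1 vXX = x by rewrite fr.
  have vp1 : vars s1 vP = P by rewrite fr.
  have aS : agree L g b e x P i.+1 = agree L g b e x P i &&
      (in_window L g b e i ==> (digit 2 (wpos L b e i) x == digit 2 i P)).
    by rewrite /agree -[i.+1]addn1 iotaD all_cat /= add0n andbT.
  have evH : eval (emul (einw L g (EV vE) (EV vV))
        (eadd (esub (ebit (EV vXX) (ewpos L (EV vE) (EV vV))) (ebit (EV vP) (EV vV)))
              (esub (ebit (EV vP) (EV vV)) (ebit (EV vXX) (ewpos L (EV vE) (EV vV)))))) s1 != 0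
      = ~~ (in_window L g b e i ==> (digit 2 (wpos L b e i) x == digit 2 i P)).
    have evM y z : eval (emul y z) s1 = eval y s1 * eval z s1 by [].
    have evA y z : eval (eadd y z) s1 = eval y s1 + eval z s1 by [].
    have evB y z : eval (esub y z) s1 = eval y s1 - eval z s1 by [].
    have evb y z : eval (ebit y z) s1 = digit 2 (eval z s1) (eval y s1) by [].
    have evV v : eval (EV v) s1 = vars s1 v by [].
    rewrite evM muln_eq0 negb_or (eval_inw _ _ st1) evA !evB !evb (eval_wpos _ _ st1).
    rewrite !evV ve1 vx1 vp1 vi.
    by rewrite negb_imply; congr andb; lia.
  apply: spec_ite => //.
    rewrite evH => /negbTE na; apply: spec_asg => //; first by rewrite /= expn_gt0.
    by rewrite /= /upd /= aS na andbF andbF.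
  move=> z; apply: spec_skip; rewrite /= /upd /= aS oki.
  by move: evH; rewrite z /= => /esym/negbFE ->; rewrite andbT.
- by rewrite /=; lia.
Qed.

(** The two zeros are the header cells, still blank while edges are being pushed. *)
Definition has_edges (cur : nat) (E : seq (nat * nat)) (s : state) :=
  [/\ vars s vCNT = size E,
      forall a, vmem base cur (cells s) a = nth 0 [:: 0, 0 & flat E] a
    & stamped base cur (cells s)].

(** The head is evaluated after the tail has been stored, hence the demand that [c] not depend on
    the memory. *)
Lemma spec_push cur E a c s T : vars s vBASE = base -> vars s vCUR = cur ->
  has_edges cur E s -> size E + 1 < 2 ^ h -> eval a s < 2 ^ h -> eval c s < 2 ^ h ->
  (forall M, eval c (State (vars s) M) = eval c s) -> 60 + esz a + esz c <= T ->
  spec h (push a c) s T (fun s' =>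
    [/\ has_edges cur (rcons E (eval a s, eval c s)) s', low_eq base (cells s) (cells s')
      & forall v, v != vCNT -> vars s' v = vars s v]).
Proof.
move=> sb sc [cn vm st] lt_sz lt_a lt_c cM le_T.
apply: (@spec_seq _ _ _ _ (25 + esz a) _ _ (fun s1 => [/\ vars s1 = vars s,
   low_eq base (cells s) (cells s1), stamped base cur (cells s1)
  & forall x, vmem base cur (cells s1) x =
      upd (vmem base cur (cells s)) (2 + 2 * size E) (eval a s) x])).
- lia.
- apply: spec_vstore => //=; first by lia.
  move=> s1 vs; rewrite sb sc cn => vm1 st1 lo1; split => //; exact: st1.
move=> s1 [vs1 lo1 st1 vm1].
have ec1 : eval c s1 = eval c s by rewrite -(cM (cells s1)) -vs1; case: (s1).
apply: (@spec_seq _ _ _ _ (25 + esz c) _ _ (fun s2 => [/\ vars s2 = vars s,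
   low_eq base (cells s) (cells s2), stamped base cur (cells s2)
  & forall x, vmem base cur (cells s2) x =
      nth 0 [:: 0, 0 & flat (rcons E (eval a s, eval c s))] x])).
- lia.
- apply: spec_vstore => //=; first by lia.
    by rewrite ec1.
  move=> s2; rewrite vs1 sb sc cn ec1 => vs2 vm2 st2 lo2; split => //.
  + exact: low_eq_trans lo1 lo2.
  + exact: st2.
  + by move=> x; rewrite vm2 nth_flat_rcons /upd vm1 /upd vm.
move=> s2 [vs2 lo2 st2 vm2]; apply: spec_asg => //=; first by lia.
  by rewrite vs2 cn.
split => //; last by move=> v /negbTE; rewrite /upd vs2 => ->.
by split => //; rewrite /= /upd /= vs2 cn size_rcons addn1.
Qed.

Let S := n + m + 1.

Let ok (W k P : nat) := ok_edge L g b m I W k P.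

Lemma spec_edge W k P e x cur E s T : static s -> vars s vE = e -> e < L ->
  vars s vXX = x -> x < X -> vars s vTH = digit m.+1 e W -> vars s vK = k -> k <= n ->
  vars s vP = P -> vars s vCUR = cur -> has_edges cur E s -> size E + 1 < 2 ^ h ->
  S * 800 <= T ->
  spec h (edge_body L g) s T (fun s' =>
    has_edges cur (E ++ if ok W k P e x then [:: edge_of L g Z e x] else [::]) s' /\
    low_eq base (cells s) (cells s')).
Proof.
move=> st ve lt_e vx lt_x vth vk le_k vp vc he lt_E le_T.
have lt_Y : (edge_of L g Z e x).1 < 2 ^ h /\ (edge_of L g Z e x).2 < 2 ^ h.
  have A a r : a < L -> r < Y -> a * Y + r < 2 ^ h.
    move=> lt_a lt_r; have : a.+1 * Y <= L * Y by rewrite leq_mul2r lt_a orbT.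
    by rewrite mulSn; lia.
  split; apply: A; rewrite ?ltn_pmod //; first by lia.
  by rewrite ltn_divLR // mulnC -expnS.
apply: spec_asg_seq; [by rewrite /=; lia|by rewrite /= expn_gt0|].
set s0 := set_var s _ _.
have st0 : static s0.
  by apply: (@static_frame (pred1 vS) s) => // v /negbTE; rewrite /= /upd => ->.
have sp1 := spec_frame (@spec_weight s0 e x (m * 170 + 10) st0 ve vx erefl (leqnn _))
  (isT : mods (fun v => v \in [:: vS; vJ]) (For vJ (EV vM) (weight_body L))).
apply: (spec_seq _ sp1) => [|s1 [w1 fr1 /(_ isT) me1]]; first by rewrite /=; lia.
have st1 : static s1 by apply: (static_frame _ fr1) => //; rewrite me1.
apply: spec_asg_seq; [by rewrite /=; lia|by rewrite /=; apply: leq_ltn_trans (leq_subr _ _) _; lia|].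
set s2 := set_var s1 _ _.
have st2 : static s2.
  by apply: (@static_frame (pred1 vOK) s1) => // v /negbTE; rewrite /= /upd => ->.
have fr2 v : v \notin [:: vS; vJ; vOK] -> vars s2 v = vars s v.
  rewrite !inE !negb_or => /and3P[nS nJ /negbTE nO].
  rewrite /= /upd nO fr1 ?inE ?(negbTE nS) //=.
  by rewrite /upd (negbTE nS).
have sp3 := spec_frame (@spec_agree s2 e x P k (k * 90 + 10) st2 (etrans (fr2 vE isT) ve)
  (etrans (fr2 vXX isT) vx) (etrans (fr2 vP isT) vp) (etrans (fr2 vK isT) vk) le_k (leqnn _))
  (isT : mods (fun v => v \in [:: vOK; vV]) (For vV (EV vK) (agree_body L g))).
apply: (spec_seq _ sp3) => [|s3 [w3 fr3 /(_ isT) me3]]; first by rewrite /=; lia.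
have st3 : static s3 by apply: (static_frame _ fr3) => //; rewrite me3.
have okE : (vars s3 vOK != 0) = ok W k P e x.
  rewrite w3 /= /upd /= w1 fr1 //= /upd /= vth /ok /ok_edge; congr (_ && _).
  by move: (weight _ _ _ _ _ _ _) (digit _ _ _) => c d; lia.
have frs v : v \notin [:: vS; vJ; vOK; vV] -> vars s3 v = vars s v.
  rewrite !inE !negb_or => /and4P[nS nJ nO nV].
  rewrite fr3 ?inE ?(negbTE nO) ?(negbTE nV) // fr2 // !inE.
  by rewrite (negbTE nS) (negbTE nJ) (negbTE nO).
have me : cells s3 = cells s by rewrite me3 /= me1.
have he3 : has_edges cur E s3 by case: he => *; split; rewrite ?me ?frs.
apply: spec_ite => [|nz|z]; first by rewrite /=; lia.
  have e1 : eval (eadd (emul (EV vE) (EV vY)) (emod (EV vXX) (EV vY))) s3 = (edge_of L g Z e x).1.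
    by rewrite /= !frs // ve vx (par_Y st).
  have e2 : eval (eadd (emul (emod (eadd (EV vE) (EC 1)) (EC L)) (EV vY))
                       (ediv (EV vXX) (EV vZ))) s3
      = (edge_of L g Z e x).2.
    by rewrite /= !frs // ve vx (par_Y st) (par_Z st) addn1.
  have [lt1 lt2] := lt_Y.
  apply: (spec_conseq (@spec_push cur E _ _ s3 (60 + 7 + 11) _ _ he3 lt_E _ _ _ _)).
  + by rewrite (par_base st3).
  + by rewrite frs.
  + by rewrite e1.
  + by rewrite e2.
  + by [].
  + by [].
  + by rewrite /=; lia.
  move=> s' []; rewrite e1 e2 -surjective_pairing -cats1 => he' lo' _.
  by move: nz; rewrite [eval _ _]/= okE => ->; rewrite -me.
apply: spec_skip; move/eqP: z; rewrite -[_ == _]negbK [eval _ _]/= okE => /negbTE->.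
by rewrite cats0 me.
Qed.

Lemma digit_sumS W e : digit_sum m W e.+1 = digit_sum m W e + digit m.+1 e W.
Proof. by rewrite /digit_sum big_ord_recr. Qed.

Lemma digit_sum_le W e : digit_sum m W e <= e * m.
Proof.
elim: e => [|e IH]; first by rewrite /digit_sum big_ord0.
by rewrite digit_sumS mulSn addnC leq_add // -ltnS digit_lt.
Qed.

Let layers_size W k P e x : e < L -> x < X ->
  size (layers L g Z (ok W k P) e ++ layer L g Z (ok W k P) e x) + M0 + 5 < 2 ^ h.
Proof.
move=> lt_e lt_x; rewrite size_cat.
have A := size_layers L g Z (ok W k P) e.
have B : size (layer L g Z (ok W k P) e x) <= x.
  by rewrite size_map size_filter (leq_trans (count_size _ _)) // size_iota.
have : e.+1 * X <= L * X by rewrite leq_mul2r lt_e orbT.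
by rewrite mulSn; move: A B; rewrite -/X; lia.
Qed.

Lemma spec_layer W k P e cur s T : static s -> vars s vE = e -> e < L ->
  vars s vW = W -> vars s vK = k -> k <= n -> vars s vP = P -> vars s vCUR = cur ->
  vars s vD = m.+1 ^ e -> vars s vTOT = digit_sum m W e ->
  has_edges cur (layers L g Z (ok W k P) e) s -> X * S * 850 <= T ->
  spec h (layer_body L g) s T (fun s' =>
    [/\ has_edges cur (layers L g Z (ok W k P) e.+1) s', low_eq base (cells s) (cells s'),
        vars s' vD = m.+1 ^ e.+1 & vars s' vTOT = digit_sum m W e.+1]).
Proof.
move=> st ve lt_e vw vk le_k vp vc vd vt he le_T.
have S_gt0 : 0 < S by rewrite /S; lia.
have XS : X <= X * S /\ S <= X * S by split; nia.
have vm := par_m st.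
have thE : (vars s vW %/ vars s vD) %% (vars s vM + 1) = digit m.+1 e W.
  by rewrite vw vd vm addn1.
have lt_th : digit m.+1 e W < 2 ^ h by apply: ltn_trans (digit_lt _ _ _) _ => //; nia.
have lt_D : m.+1 ^ e * (m + 1) < 2 ^ h.
  rewrite addn1 -expnSr; apply: leq_ltn_trans (_ : m.+1 ^ L < _); last by lia.
  by rewrite leq_pexp2l.
have lt_tot : digit_sum m W e + digit m.+1 e W < 2 ^ h.
  rewrite -digit_sumS; apply: leq_ltn_trans (digit_sum_le _ _) _.
  have : e.+1 * m <= L * m by rewrite leq_mul2r lt_e orbT.
  lia.
apply: spec_asg_seq; [by rewrite /=; lia|by rewrite [eval _ _]thE|].
rewrite [eval _ _]thE; set s1 := set_var s _ _.
apply: spec_asg_seq; [by rewrite /=; lia|by rewrite /= /upd /= vd vm|].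
have -> : eval (emul (EV vD) (eadd (EV vM) (EC 1))) s1 = m.+1 ^ e.+1.
  by rewrite /= /upd /= vd vm addn1 expnSr.
set s2 := set_var s1 _ _.
apply: spec_asg_seq; [by rewrite /=; lia|by rewrite /= /upd /= vt|].
have -> : eval (eadd (EV vTOT) (EV vTH)) s2 = digit_sum m W e.+1.
  by rewrite /= /upd /= vt digit_sumS.
set s3 := set_var s2 _ _.
have fr3 v : v \notin [:: vTH; vD; vTOT] -> vars s3 v = vars s v.
  by rewrite !inE !negb_or => /and3P[/negbTE n1 /negbTE n2 /negbTE n3]; rewrite /= /upd n1 n2 n3.
have st3 : static s3 by apply: (@static_frame (fun v => v \in [:: vTH; vD; vTOT]) s).
pose PP v := v \in [:: vXX; vS; vJ; vOK; vV; vCNT].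
apply: (@spec_for _ _ _ _ _ X _ (S * 800) PP (fun x s' =>
    has_edges cur (layers L g Z (ok W k P) e ++ layer L g Z (ok W k P) e x) s' /\
    low_eq base (cells s) (cells s'))) => //.
- lia.
- by move=> s' fr; rewrite /= fr // (par_X st3).
- by rewrite cats0; split => //; case: he => *; split.
- move=> x s' lt_x vx fr _ [he' lo'].
  have st' : static s' by apply: (@static_frame PP s3).
  have lt_sz := layers_size W k P lt_e lt_x.
  apply: (spec_conseq
    (@spec_edge W k P e x cur _ s' (S * 800) st' _ lt_e vx lt_x _ _ le_k _ _ he' _ _)) => //.
  + by rewrite fr // fr3.
  + by rewrite fr.
  + by rewrite fr // fr3.
  + by rewrite fr // fr3.
  + by rewrite fr // fr3.
  + by lia.
  move=> s'' [he'' lo'']; rewrite layerS catA; split; last exact: low_eq_trans lo' lo''.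
  by case: he'' => *; split.
- move=> s' _ fr _ [he' lo']; split => //.
  + by rewrite layersS.
  + by rewrite fr.
  + by rewrite fr.
- have -> : X * (S * 800 + esz (EV vX) + 9) = X * S * 800 + X * 10 by rewrite -addnA mulnDr mulnA.
  by case: XS le_T X_gt0 => ? _; rewrite /=; move: (X * S) (X) => q x; lia.
Qed.

Let edges_of W k P := edge_list L g Z M0 (ok W k P).

Definition graph_input W k P : seq nat :=
  [:: L * Z ^ g + M0.+2, size (edges_of W k P) & flat (edges_of W k P)].

Lemma spec_build W k P cur s T : static s -> vars s vW = W -> vars s vK = k -> k <= n ->
  vars s vP = P -> vars s vCUR = cur -> cur.+1 < 2 ^ h -> stamped base cur (cells s) ->
  L * X * S * 900 + M0 * 120 + 400 <= T ->
  spec h (build L g M0) s T (fun s' =>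
    [/\ forall a, vmem base cur.+1 (cells s') a = nth 0 (graph_input W k P) a,
        stamped base cur.+1 (cells s'), low_eq base (cells s) (cells s'),
        vars s' vCUR = cur.+1 & vars s' vTOT = digit_sum m W L]).
Proof.
move=> st vw vk le_k vp vc lt_c sta le_T.
have S_gt0 : 0 < S by rewrite /S; lia.
have LXS : L <= L * X * S by rewrite -mulnA leq_pmulr // muln_gt0 X_gt0.
have E0 : 0 < 2 ^ h by rewrite expn_gt0.
apply: spec_asg_seq; [by rewrite /=; lia|by rewrite /= vc addn1|].
rewrite [eval _ _]/= vc addn1; set s1 := set_var s _ _.
apply: spec_asg_seq; [by rewrite /=; lia|by []|].
apply: spec_asg_seq; [by rewrite /=; lia|by rewrite /=; lia|].
apply: spec_asg_seq; [by rewrite /=; lia|by []|].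
rewrite [eval _ _]/= [eval (EC 1) _]/=; set s4 := set_var _ vTOT 0.
have fr4 v : v \notin [:: vCUR; vCNT; vD; vTOT] -> vars s4 v = vars s v.
  rewrite !inE !negb_or => /and4P[/negbTE n1 /negbTE n2 /negbTE n3 /negbTE n4].
  by rewrite /= /upd n1 n2 n3 n4.
have st4 : static s4 by apply: (@static_frame (fun v => v \in [:: vCUR; vCNT; vD; vTOT]) s).
pose PP v := (10 < v) && (v < 21).
(* All stamps are at most [cur], so under the new number the memory reads as 0, whatever the
   previous call left there. *)
have he4 : has_edges cur.+1 (layers L g Z (ok W k P) 0) s4.
  split => // [a|a]; last by apply: leq_trans (sta a) _.
  rewrite /vmem /= ifF; first by case: a => [|[|[]]].
  by have := sta a; lia.
pose T1 := L * (X * S * 850 + 1 + 9) + 1 + 5.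
have le_T1 : T1 + M0 * 120 + 350 <= T.
  have -> : T1 = L * X * S * 850 + L * 10 + 6.
    by rewrite /T1 -(addnA (X * S * 850)) mulnDr !mulnA -addnA.
  by move: LXS le_T; move: (L * X * S) => q; lia.
apply: (@spec_seq _ _ _ _ T1 _ _ (fun s' => [/\ has_edges cur.+1 (layers L g Z (ok W k P) L) s',
   low_eq base (cells s) (cells s'), forall v, ~~ PP v -> vars s' v = vars s4 v
  & vars s' vTOT = digit_sum m W L])).
- by rewrite /=; lia.
- apply: (@spec_for _ _ _ _ _ L _ (X * S * 850) PP (fun e s' =>
    [/\ has_edges cur.+1 (layers L g Z (ok W k P) e) s', low_eq base (cells s) (cells s'),
        vars s' vD = m.+1 ^ e & vars s' vTOT = digit_sum m W e])) => //.
  + by split => //; rewrite /digit_sum big_ord0.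
  + move=> e s' lt_e ve fr _ [he' lo' vd vt].
    have st' : static s' by apply: (@static_frame PP s4).
    apply: (spec_conseq
      (@spec_layer W k P e cur.+1 s' _ st' ve lt_e _ _ le_k _ _ vd vt he' (leqnn _))) => //.
    * by rewrite fr // fr4.
    * by rewrite fr // fr4.
    * by rewrite fr // fr4.
    * by rewrite fr.
    move=> s'' [he'' lo'' vd' vt'].
    split; [by case: he'' => *; split|exact: (low_eq_trans lo' lo'')|by []|by []].
  + by move=> s' _ fr _ [he' lo' _ vt]; split.
move=> s5 [he5 lo5 fr5 vt5].
have st5 : static s5 by apply: (@static_frame PP s4).
have vc5 : vars s5 vCUR = cur.+1 by rewrite fr5.
have lt_LY i : i <= M0.+1 -> L * Y + i.+1 < 2 ^ h by lia.
pose PQ v := (v == vV) || (v == vCNT).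
pose T2 := M0.+1 * (60 + 3 + 7 + 1 + 9) + 1 + 5.
have [lo_sz hi_sz] := andP (size_edge_list M0 (ok W k P) L_gt1 g_gt0 Z_gt0).
apply: (@spec_seq _ _ _ _ T2 _ _ (fun s' => [/\ has_edges cur.+1 (edges_of W k P) s',
   low_eq base (cells s5) (cells s') & forall v, ~~ PQ v -> vars s' v = vars s5 v])).
- by rewrite /T2 /=; lia.
- apply: (@spec_for _ _ _ _ _ M0.+1 _ (60 + 3 + 7) PQ (fun i s' =>
    has_edges cur.+1 (layers L g Z (ok W k P) L ++ star L g Z i) s' /\
    low_eq base (cells s5) (cells s'))) => //.
  + lia.
  + by rewrite cats0; split => //; case: he5 => *; split.
  + move=> i s' lt_i vi fr _ [he' lo'].
    have st' : static s' by apply: (@static_frame PQ s5).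
    have e1 : eval (emul (EC L) (EV vY)) s' = L * Y by rewrite /= (par_Y st').
    have e2 : eval (eadd (emul (EC L) (EV vY)) (eadd (EV vV) (EC 1))) s' = L * Y + i.+1.
      by rewrite /= (par_Y st') vi addn1.
    have lt_sz : size (layers L g Z (ok W k P) L ++ star L g Z i) + 1 < 2 ^ h.
      rewrite size_cat [size (star _ _ _ _)]size_map size_iota.
      by have := size_layers L g Z (ok W k P) L; rewrite -/X; lia.
    apply: (spec_conseq (@spec_push cur.+1 _ _ _ s' (60 + 3 + 7) _ _ he' lt_sz _ _ _ _)) => //.
    * by rewrite (par_base st').
    * by rewrite fr // vc5.
    * by rewrite e1; have := lt_LY 0 isT; lia.
    * by rewrite e2; apply: lt_LY; lia.
    move=> s'' [he'' lo'' _]; rewrite starS -rcons_cat.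
    rewrite e1 e2 in he''; split; last exact: low_eq_trans lo' lo''.
    by case: he'' => *; split.
  + by move=> s' _ fr _ [he' lo']; split.
move=> s6 [he6 lo6 fr6].
have st6 : static s6 by apply: (@static_frame PQ s5).
have {}lo6 := low_eq_trans lo5 lo6.
have vc6 : vars s6 vCUR = cur.+1 by rewrite fr6.
have vb6 : vars s6 vBASE = base by rewrite (par_base st6).
have [cn6 vm6 sta6] := he6.
apply: (@spec_seq _ _ _ _ 30 _ _ (fun s' => [/\ vars s' = vars s6,
  stamped base cur.+1 (cells s'), low_eq base (cells s) (cells s')
  & forall a, vmem base cur.+1 (cells s') a =
    nth 0 [:: L * Z ^ g + M0.+2, 0 & flat (edges_of W k P)] a])).
- by rewrite /T2 /=; lia.
- apply: spec_vstore => //.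
    by rewrite /= (par_Y st6); have := lt_LY M0.+1 (leqnn _).
  move=> s'; rewrite vb6 vc6 [eval _ _]/= [eval (eadd _ _) _]/= (par_Y st6) => vs' vm' sta' lo'.
  split => //; first exact: sta'.
    exact: low_eq_trans lo6 lo'.
  by move=> a; rewrite vm' /upd vm6; case: a => [|a].
move=> s7 [vs7 sta7 lo7 vm7].
apply: spec_vstore => //.
- by rewrite /T2 /=; lia.
- by rewrite /= vs7 cn6 /edges_of; move: hi_sz; rewrite -/X; lia.
move=> s'; rewrite vs7 vb6 vc6 [eval _ _]/= [eval (EV _) _]/= vs7 cn6 => vs' vm' sta' lo'.
split => //.
- by move=> a; rewrite vm' /upd vm7 /graph_input; case: a => [|[|a]].
- exact: sta'.
- exact: low_eq_trans lo7 lo'.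
- by rewrite vs' vc6.
- by rewrite vs' fr6.
Qed.

Variables (tG : nat) (query : nat -> nat -> nat -> bool).
Hypothesis oracle : forall W k P, k <= n -> exists w t c,
  [/\ w <= h, t <= tG, halts_in w p (init (graph_input W k P)) t c
    & memory c 0 = query W k P].

(** The complement consists of the parameters, the arguments [vW], [vK], [vP] of a query, and the
    variables [vBEST] to [vI] of the outer loops; all of these survive a query. *)
Let query_mods : pred nat := fun v => [|| v == vCUR, 10 < v < 22 | 26 < v].

Definition query_time :=
  L * X * S * 900 + M0 * 120 + 400 + ((6 * size p + 50) * tG + 2 * nregs p + 10) + 40.

Lemma mods_run_query : mods query_mods (run_query L g M0 p).
Proof.
apply/andP; split => //; apply/andP; split => //.
by apply: mods_sub (mods_call p) => v /= lt_v; rewrite /query_mods lt_v !orbT.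
Qed.

Lemma spec_run_query W k P cur s : static s -> vars s vW = W -> vars s vK = k -> k <= n ->
  vars s vP = P -> vars s vCUR = cur -> cur.+1 < 2 ^ h -> stamped base cur (cells s) ->
  spec h (run_query L g M0 p) s query_time (fun s' =>
    [/\ [/\ static s', vars s' vCUR = cur.+1 & stamped base cur.+1 (cells s')],
        vars s' vRES = query W k P, vars s' vTOT = digit_sum m W L
      & forall v, ~~ query_mods v -> vars s' v = vars s v]).
Proof.
move=> st vw vk le_k vp vc lt_c sta.
suff sp : spec h (run_query L g M0 p) s query_time (fun s' =>
    [/\ low_eq base (cells s) (cells s'), vars s' vCUR = cur.+1, stamped base cur.+1 (cells s'),
        vars s' vRES = query W k P & vars s' vTOT = digit_sum m W L]).
  apply: (spec_conseq (spec_frame sp mods_run_query)) => // s' [[lo c' st' r' t'] fr _].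
  by split => //; split => //; apply: (static_frame _ fr).
have [w [t [c [le_w le_t hal ans]]]] := oracle W P le_k.
have le_kt : (6 * size p + 50) * t <= (6 * size p + 50) * tG by rewrite leq_mul2l le_t orbT.
apply: (spec_seq _ (spec_frame (spec_build st vw vk le_k vp vc lt_c sta (leqnn _))
    (isT : mods query_mods (build L g M0)))); first by rewrite /query_time; lia.
move=> s1 [[vm1 sta1 lo1 c1 t1] fr1 _].
have b1 : vars s1 vBASE = base by rewrite fr1 // (par_base st).
apply: (spec_seq _ (@spec_call h w base cur.+1 p (graph_input W k P) t c s1 (fun s2 =>
  [/\ forall v, v < 27 -> vars s2 v = vars s1 v, vmem base cur.+1 (cells s2) 0 = query W k P,
      stamped base cur.+1 (cells s2) & low_eq base (cells s1) (cells s2)])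
  le_w bnd_size bnd_jump hal b1 c1 vm1 sta1 _)) => //.
- by rewrite /query_time; lia.
- by move=> s2 fr vm2 sta2 lo2; split => //; rewrite vm2 ans.
move=> s2 [fr2 vm2 sta2 lo2].
have ev : eval (vload (EC 0)) s2 = query W k P by rewrite eval_vload !fr2 // b1 c1.
apply: spec_asg.
- by rewrite /query_time /=; lia.
- by rewrite ev; case: (query _ _ _); lia.
rewrite ev; split => //=.
- exact: low_eq_trans lo1 lo2.
- by rewrite /upd /= fr2.
- by rewrite /upd /= fr2.
Qed.

(** That the cells from [base] on are still 0 is recorded because it gives [stamped base 0], the
    starting point for the numbering of the queries. *)
Lemma spec_setup s : cells s = I -> I 0 = n -> I 1 = m ->
  (forall a, 2 + 3 * m <= a -> I a = 0) -> b = n %/ L + 1 ->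
  spec h (setup L g) s (L * (m * 110 + 60) + 100) (fun s' =>
    [/\ static s', vars s' vNW = m.+1 ^ L, forall a, base <= a -> cells s' a = 0
      & forall v, ~~ ((v < 7) || (v \in [:: vE; vJ; vNW])) -> vars s' v = vars s v]).
Proof.
move=> cI In Im I0 bE.
suff sp : spec h (setup L g) s (L * (m * 110 + 60) + 100) (fun s' =>
    [/\ static s', vars s' vNW = m.+1 ^ L & forall a, base <= a -> cells s' a = 0]).
  apply: (spec_conseq (spec_frame sp (P := fun v => (v < 7) || (v \in [:: vE; vJ; vNW])) isT)) => //.
  by move=> s' [[a1 a2 a3] fr _]; split.
have lt_b : b < Z by apply: ltn_expl.
have le_ZX : Z <= X by rewrite -{1}(expn1 Z) leq_pexp2l.
have le_YX : Y <= X by rewrite leq_pexp2l.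
have le_T : L * (m * 110 + 60) + 100 <= L * (m * 110 + 60) + 100 by [].
move: {-1}(L * _ + _) le_T => T le_T.
apply: (@spec_asg_val _ _ _ n); [by rewrite /= cI|by rewrite /=; lia|by lia|].
apply: (@spec_asg_val _ _ _ m); [by rewrite /= cI|by rewrite /=; lia|by lia|].
apply: (@spec_asg_val _ _ _ b); [by rewrite bE|by rewrite /=; lia|by lia|].
apply: (@spec_asg_val _ _ _ Z); [by rewrite /= /upd /= mul1n|by rewrite /=; lia|by lia|].
apply: (@spec_asg_val _ _ _ Y); [by rewrite /= /upd /= mul1n expnM|by rewrite /=; lia|by lia|].
apply: (@spec_asg_val _ _ _ X); [by rewrite /= /upd /= mul1n expnM|by rewrite /=; lia|by lia|].
apply: (@spec_asg_val _ _ _ base); [by []|by rewrite /=; lia|by rewrite /base; lia|].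
set s1 := set_var _ vBASE base.
have par1 : params s1 by split => //= a _; rewrite cI.
have c1 : cells s1 = I by [].
pose T1 := L * (m * 110 + 10 + 1 + 9) + 1 + 5.
have T1E : T1 = L * (m * 110) + L * 20 + 6 by rewrite /T1 -!(addnA (m * 110)) mulnDr -addnA.
rewrite mulnDr in le_T.
apply: (@spec_seq _ _ _ _ T1 _ _ (fun s' => static s' /\ forall a, base <= a -> cells s' a = 0)).
- by rewrite /=; lia.
- apply: (@spec_for _ _ _ _ _ L _ (m * 110 + 10) (fun v => v \in [:: vE; vJ]) (fun e s' =>
    [/\ params s', forall j, j < m -> cells s' (2 + 3 * m + j) = home L g b I e j
      & forall a, base <= a -> cells s' a = 0])) => //.
  + split.
    * by apply: (@params_frame (pred1 vE) s1) => // v /negbTE; rewrite /= /upd => ->.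
    * by move=> j _; rewrite /= cI I0 //; lia.
    * by move=> a le_a; rewrite /= cI I0 //; move: le_a; rewrite /base; lia.
  + move=> e s' lt_e ve fr _ [par' hm' hi'].
    apply: (spec_conseq (spec_home_inner par' ve lt_e hm' hi' (leqnn _))) => //.
    move=> s'' [par'' fr'' hm'' hi'']; split => //.
    by apply: (@params_frame (pred1 vE) s'') => // v /negbTE; rewrite /= /upd => ->.
  + by move=> s' _ _ _ [par' hm' hi']; split => //; split.
move=> s2 [st2 hi2].
apply: (@spec_asg_val _ _ _ 1); [by []|by rewrite /=; lia|by lia|].
apply: (@spec_for _ _ _ _ _ L _ 10 (fun v => v \in [:: vE; vNW])
  (fun e s' => vars s' vNW = m.+1 ^ e)) => //.
- move=> e s' lt_e ve fr _ vn.
  have ev : eval (emul (EV vNW) (eadd (EV vM) (EC 1))) s' = m.+1 ^ e.+1.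
    by rewrite /= vn fr //= /upd /= (par_m st2) addn1 expnSr.
  have le_e : m.+1 ^ e.+1 <= m.+1 ^ L by rewrite leq_pexp2l.
  by apply: spec_asg => //; rewrite ev //; lia.
- move=> s' _ fr /(_ isT) me vn; split => //; last by rewrite me.
  apply: (@static_frame (fun v => v \in [:: vE; vNW]) s2) => //; last by rewrite me.
  by move=> v nv; rewrite fr //= /upd; move: nv; rewrite !inE negb_or => /andP[_ /negbTE->].
- by rewrite /=; lia.
Qed.

Lemma spec_max3sat s : cells s = I -> (forall v, vars s v = 0) -> I 0 = n -> I 1 = m ->
  (forall a, 2 + 3 * m <= a -> I a = 0) -> b = n %/ L + 1 ->
  spec h (max3sat_cmd L g M0 p) s
    ((m.+1 ^ L + n) * (query_time + 100) + L * (m * 110 + 60) + 300)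
    (fun s' => forall i, i < n -> cells s' i =
       digit 2 i (fix_bits query (search_best L m query (m.+1 ^ L)).2 n)).
Proof.
move=> cI v0 In Im I0 bE.
have [NW NWE] : exists NW, NW = m.+1 ^ L by exists (m.+1 ^ L).
have bnd_NW : NW + n + 2 < 2 ^ h by rewrite NWE.
rewrite -NWE; set TQ := query_time.
have le_T : NW * (TQ + 100) + n * (TQ + 100) + L * (m * 110 + 60) + 300 <=
  (NW + n) * (TQ + 100) + L * (m * 110 + 60) + 300 by rewrite mulnDl.
move: ((NW + n) * _ + _ + _) le_T => T le_T.
have ge1 : n <= n * (TQ + 100) by rewrite leq_pmulr // addn_gt0 orbT.
apply: (spec_seq _ (spec_setup cI In Im I0 bE)); first by lia.
move=> s1 [st1 nw1 hi1 fr1]; rewrite -NWE in nw1.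
have le_T1 : NW * (TQ + 60 + 10) + 10 + n * (TQ + 100) + 170 <= T - (L * (m * 110 + 60) + 100).
  have : NW * (TQ + 60 + 10) <= NW * (TQ + 100) by rewrite leq_mul2l; apply/orP; right; lia.
  lia.
move: (T - _) le_T1 => {le_T}T le_T.
pose PB v := query_mods v || (v \in [:: vW; vBEST; vBESTW]).
apply: (@spec_seq _ _ _ _ (NW * (TQ + 60 + 10) + 10) _ _ (fun s' =>
  [/\ static s', vars s' vCUR = NW, stamped base NW (cells s'),
      vars s' vBESTW = (search_best L m query NW).2 & forall v, ~~ PB v -> vars s' v = vars s1 v])).
- lia.
- apply: (@spec_for _ _ _ _ _ NW _ (TQ + 60) PB (fun W s' =>
    [/\ static s', vars s' vCUR = W, stamped base W (cells s'),
      vars s' vBEST = (search_best L m query W).1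
    & vars s' vBESTW = (search_best L m query W).2])) => //.
  + lia.
  + have md : mods (fun v => PB v && (v != vW)) (run_query L g M0 p).
      apply: mods_sub mods_run_query => v qv; rewrite /PB qv /=.
      by apply: contraTN qv => /eqP->.
    exact/andP.
  + by move=> s' fr; rewrite /= fr.
  + split => //=; rewrite /upd /=; try by rewrite fr1 ?v0.
      by apply: (@static_frame (pred1 vW) s1) => // v /negbTE; rewrite /= /upd => ->.
    by move=> a; rewrite hi1 //; lia.
  + move=> W s' lt_W vw fr _ [st' c' sta' b' bw'].
    (* While the guesses are tried no variable is prescribed: [vK] and [vP] still have their initial
       value. *)
    have k' : vars s' vK = 0 by rewrite fr // fr1.
    have p' : vars s' vP = 0 by rewrite fr // fr1.
    apply: (spec_seq _ (spec_run_query st' vw k' (leq0n n) p' c' _ sta')); try by lia.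
    move=> s2 [[st2 c2 sta2] r2 t2 fr2].
    have lt_tot : digit_sum m W L < 2 ^ h by apply: leq_ltn_trans (digit_sum_le _ _) _; lia.
    have b2 : vars s2 vBEST = (search_best L m query W).1 by rewrite fr2.
    have bw2 : vars s2 vBESTW = (search_best L m query W).2 by rewrite fr2.
    have w2 : vars s2 vW = W by rewrite fr2.
    have tE : (eval (emul (EV vRES) (esub (EV vTOT) (EV vBEST))) s2 != 0) =
        query W 0 0 && ((search_best L m query W).1 < digit_sum m W L).
      by rewrite /= r2 t2 b2 muln_eq0 negb_or eqb0 negbK -lt0n subn_gt0.
    apply: spec_ite => [|nz|z]; first by rewrite /=; lia.
    * move: nz; rewrite tE => qE.
      apply: (@spec_asg_val _ _ _ (digit_sum m W L)) => //; first by rewrite /=; lia.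
      apply: spec_asg; [by rewrite /=; lia|by rewrite /= /upd /= w2; lia|].
      rewrite [eval _ _]/= /upd /= w2 qE.
      split => //.
      by apply: (@static_frame (fun u => 7 < u) s2) => // u; rewrite -leqNgt => le_u;
         rewrite /= /upd !ifF //; lia.
    * move/eqP: z; rewrite -[_ == _]negbK tE => /negbTE qE.
      apply: spec_skip; split; rewrite /= ?qE //.
      by apply: (@static_frame (pred1 vW) s2) => // v /negbTE; rewrite /= /upd => ->.
  + by move=> s' _ fr _ [*]; split.
  + by rewrite /=; lia.
move=> s2 [st2 c2 sta2 bw2 fr2].
set Wb := (search_best L m query NW).2 in bw2 *.
have lt_Wb : Wb < 2 ^ h by have := search_best2_lt L m query NW; rewrite -/Wb; lia.
apply: (@spec_asg_val _ _ _ Wb) => //; first by rewrite /=; lia.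
apply: (@spec_asg_val _ _ _ 1) => //; [by rewrite /=; lia|by lia|].
set s3 := set_var _ vQ 1.
have st3 : static s3.
  apply: (@static_frame (fun u => 7 < u) s2) => // u; rewrite -leqNgt => le_u.
  by rewrite /= /upd !ifF //; lia.
have p3 : vars s3 vP = 0 by rewrite /= /upd /= fr2 // fr1.
pose PF v := query_mods v || (v \in [:: vI; vK; vP; vQ]).
apply: (@spec_seq _ _ _ _ (n * (TQ + 60 + 10) + 10) _ _ (fun s' =>
  vars s' vN = n /\ vars s' vP = fix_bits query Wb n)).
- have : n * (TQ + 60 + 10) + n * 30 <= n * (TQ + 100).
    by rewrite -mulnDr leq_mul2l; apply/orP; right; lia.
  by rewrite /=; lia.
- apply: (@spec_for _ _ _ _ _ n _ (TQ + 60) PF (fun i s' =>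
    [/\ static s', vars s' vCUR = NW + i, stamped base (NW + i) (cells s'),
      vars s' vP = fix_bits query Wb i & vars s' vQ = 2 ^ i])) => //.
  + lia.
  + have md : mods (fun v => PF v && (v != vI)) (run_query L g M0 p).
      apply: mods_sub mods_run_query => v qv; rewrite /PF qv /=.
      by apply: contraTN qv => /eqP->.
    by apply/andP; split => //; apply/andP; split => //; apply/andP.
  + by move=> s' fr; rewrite /= fr // (par_n st3).
  + split => //; rewrite ?addn0 //=.
    by apply: (@static_frame (pred1 vI) s3) => // v /negbTE; rewrite /= /upd => ->.
  + move=> i s' lt_i vi fr _ [st' c' sta' p' q'].
    have lt_P := fix_bits_lt query Wb i.
    have le_2 : 2 ^ i.+1 <= 2 ^ n by rewrite leq_exp2l.
    rewrite expnS in le_2; have := bnd_bits; rewrite expnS => bnd2.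
    apply: (@spec_asg_val _ _ _ i.+1); [by rewrite /= vi addn1|by rewrite /=; lia|by lia|].
    apply: (@spec_asg_val _ _ _ (fix_bits query Wb i + 2 ^ i));
      [by rewrite /= /upd /= p' q'|by rewrite /=; lia|by lia|].
    set s4 := set_var _ vP _.
    have st4 : static s4.
      apply: (@static_frame (fun u => 7 < u) s') => // u; rewrite -leqNgt => le_u.
      by rewrite /= /upd !ifF //; lia.
    have w4 : vars s4 vW = Wb by rewrite /= /upd /= fr.
    have lt_c4 : (NW + i).+1 < 2 ^ h by lia.
    apply: (spec_seq _ (@spec_run_query Wb i.+1 (fix_bits query Wb i + 2 ^ i) (NW + i) s4
      st4 w4 erefl lt_i erefl c' lt_c4 sta')); first by rewrite /= -/TQ; lia.
    move=> s5 [[st5 c5 sta5] r5 t5 fr5].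
    have p5 : vars s5 vP = fix_bits query Wb i + 2 ^ i by rewrite fr5.
    have q5 : vars s5 vQ = 2 ^ i by rewrite fr5 //= /upd /= q'.
    apply: (@spec_seq _ _ _ _ 20 _ _ (fun s6 => [/\ static s6, vars s6 vCUR = (NW + i).+1,
      stamped base (NW + i).+1 (cells s6), vars s6 vP = fix_bits query Wb i.+1
      & vars s6 vQ = 2 ^ i])).
    * by rewrite /= -/TQ; lia.
    * apply: spec_ite => //; rewrite [eval _ _]/= r5.
        rewrite eqb0 negbK => qE; apply: spec_skip; split => //.
        by rewrite p5 /= qE.
      move=> /eqP; rewrite eqb0 => /negbTE qE.
      apply: spec_asg => //; rewrite [eval _ _]/= p5 q5 addnK; first by lia.
      split => //=; last by rewrite /upd /= qE.
      by apply: (@static_frame (pred1 vP) s5) => // v /negbTE; rewrite /= /upd => ->.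
    move=> s6 [st6 c6 sta6 p6 q6].
    apply: spec_asg => /=; [by rewrite -/TQ; lia|by rewrite q6; lia|].
    split => //=; rewrite ?addnS //; last by rewrite /upd /= q6 expnSr.
    apply: (@static_frame (fun u => 7 < u) s6) => // u; rewrite -leqNgt => le_u.
    by rewrite /= /upd !ifF //; lia.
  + by move=> s' _ fr _ [st' _ _ p' _]; split => //; rewrite (par_n st').
  + by rewrite /=; lia.
move=> s4 [n4 p4].
apply: (@spec_for _ _ _ _ _ n _ 10 (pred1 vI) (fun i s' => forall j, j < i ->
  cells s' j = digit 2 j (fix_bits query Wb n))) => //.
- lia.
- by move=> s' fr; rewrite /= fr.
- move=> i s' lt_i vi fr _ IH.
  have ev : eval (ebit (EV vP) (EV vI)) s' = digit 2 i (fix_bits query Wb n).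
    by rewrite /= vi fr // p4.
  apply: spec_sto => //.
    by rewrite ev; apply: ltn_trans (digit_lt _ _ _) _ => //; lia.
  move=> j; rewrite ltnS ev /= /upd vi; case: eqP => [->//|ne le_j]; apply: IH.
  by move: le_j; rewrite leq_eqVlt => /orP[/eqP|].
- have : n * (TQ + 60 + 10) + n * 30 <= n * (TQ + 100).
    by rewrite -mulnDr leq_mul2l; apply/orP; right; lia.
  by rewrite /=; lia.
Qed.

End Correctness.

(** * The reduction *)

Section Reduction.

Variables (L g M0 : nat) (p : program) (kp : nat) (t : digraph -> nat) (tG : cnf3 -> nat).
Hypotheses (L_gt1 : 1 < L) (g_gt0 : 0 < g) (g_lt : g < L) (ceilL : 3 * (L - g) <= L + 2).

(** Adding 1 instead of rounding up keeps groups nonempty even without variables, and gives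
    [nvars F < L * group_size F]; it costs a constant factor in the number of edges. *)
Definition group_size (F : cnf3) : nat := nvars F %/ L + 1.
Definition window_count (F : cnf3) : nat := (2 ^ group_size F) ^ g.+1.

Hypothesis p_solves : forall G : digraph, exists k c,
  [/\ k <= t G,
      halts_in (kp * (trunc_log 2 (nverts G + nedges G + t G)).+1) p
        (init (digraph_input G)) k c
    & memory c 0 = has_cycle L G].
Hypothesis p_time : forall (F : cnf3) (G : digraph),
  M0 < nedges G <= L * window_count F + M0.+1 -> t G <= tG F.

Definition total_time (F : cnf3) : nat :=
  ((nclauses F).+1 ^ L + nvars F) *
    (query_time L g M0 p (nvars F) (nclauses F) (group_size F) (tG F) + 100)
  + L * (nclauses F * 110 + 60) + 300.

Lemma reduction_solves :
  solves (Q := max3sat) (ccmd 0 (max3sat_cmd L g M0 p)) total_time.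
Proof.
(* [kp] makes room for the words of the interpreted program, [L] for a whole assignment in one word,
   [size p] and [jump_bound p] for its program counter. *)
pose k1 := kp + L + size p + jump_bound p + 1.
exists (cw (max3sat_cmd L g M0 p) * k1) => F.
rewrite [inst_size _]/=.
set n := nvars F; set m := nclauses F; set b := group_size F.
set lg := (trunc_log 2 _).+1; set T := total_time F in lg *.
pose h := k1 * lg; rewrite -mulnA -/h.
pose I := nth 0 (cnf3_input F).
have Z_gt0 : 0 < 2 ^ b by rewrite expn_gt0.
have Y_gt0 : 0 < (2 ^ b) ^ g by rewrite expn_gt0 Z_gt0.
have X_gt0 : 0 < (2 ^ b) ^ g.+1 by rewrite expn_gt0 Z_gt0.
have YX : (2 ^ b) ^ g <= (2 ^ b) ^ g.+1 by rewrite leq_pexp2l.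
have XE : window_count F = (2 ^ b) ^ g.+1 by [].
have b_gt0 : 0 < b by rewrite /b /group_size addn1.
have n_lt : n < L * b.
  by rewrite /b /group_size addn1 -/n mulnC -ltn_divLR // ltnW.
pose TQ := query_time L g M0 p n m b (tG F).
have TE : T = (m.+1 ^ L + n) * (TQ + 100) + L * (m * 110 + 60) + 300 by [].
have NW_gt0 : 0 < m.+1 ^ L by rewrite expn_gt0.
have T_ge1 : TQ + 100 + L * (m * 110 + 60) + 300 <= T.
  have : TQ + 100 <= (m.+1 ^ L + n) * (TQ + 100) by rewrite leq_pmull // addn_gt0 NW_gt0.
  by rewrite TE; lia.
have T_ge2 : (m.+1 ^ L + n) * 100 + 300 <= T.
  have : (m.+1 ^ L + n) * 100 <= (m.+1 ^ L + n) * (TQ + 100) by rewrite leq_mul2l leq_addl orbT.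
  by rewrite TE; lia.
have TQ_ge : L * (2 ^ b) ^ g.+1 * 900 + M0 * 120 + 400 + 50 * tG F <= TQ.
  have A1 : L * (2 ^ b) ^ g.+1 <= L * (2 ^ b) ^ g.+1 * (n + m + 1) by rewrite leq_pmulr // addn1.
  have A2 : 50 * tG F <= (6 * size p + 50) * tG F by rewrite leq_mul2r leq_addl orbT.
  rewrite /TQ /query_time; move: A1 A2; move: (L * (2 ^ b) ^ g.+1 * (n + m + 1)) => q.
  by move: ((6 * size p + 50) * tG F) (L * (2 ^ b) ^ g.+1) (2 ^ b ^ g.+1) => *; lia.
have lt_lg : n + m + T < 2 ^ lg by apply: trunc_log_ltn.
have le_lgh : lg <= h by rewrite leq_pmull // /k1 addn1.
(* The word length follows the logarithm of the total time, so whatever is bounded by the time fits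
   into a word. *)
have lt_h x : x <= T -> x < 2 ^ h.
  move=> le_x; apply: leq_ltn_trans (_ : T < _) => //.
  by apply: leq_ltn_trans (leq_addl _ _) (leq_trans lt_lg _); rewrite leq_exp2l.
have lg_gt0 : 0 < lg by [].
have lt_k1 x : x <= k1 -> x < 2 ^ h.
  move=> le_x; apply: leq_trans (ltn_expl x (isT : 1 < 2)) _; rewrite leq_exp2l //.
  by apply: leq_trans le_x _; rewrite leq_pmulr.
have LY : L * (2 ^ b) ^ g <= L * (2 ^ b) ^ g.+1 by rewrite leq_mul2l YX orbT.
have XL : (2 ^ b) ^ g.+1 <= L * (2 ^ b) ^ g.+1 by rewrite leq_pmull // ltnW.
have mL : 2 * m <= L * m by rewrite leq_mul2r L_gt1 orbT.
(* The running time exceeds [2 ^ b], so [lg > b]; the factor [L] in [k1] then yields more than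
   [L * b > n] bits. *)
have bnd_bits : 2 ^ n.+1 < 2 ^ h.
  rewrite ltn_exp2l //; apply: leq_trans (_ : (L * b).+1 <= _); first by [].
  have lt_b : b < lg.
    rewrite -(@ltn_exp2l 2) //; apply: leq_ltn_trans lt_lg.
    apply: leq_trans (_ : (2 ^ b) ^ g.+1 <= _); first by rewrite -{1}(expn1 (2 ^ b)) leq_pexp2l.
    lia.
  apply: leq_trans (_ : L * lg <= _); first by rewrite ltn_mul2l lt_b andbT ltnW.
  by rewrite leq_mul2r /k1; apply/orP; right; lia.
pose okF W k P := ok_edge L g b m I W k P.
pose Gs W k P := digraph_of_nat_edges (uniq_edge_list M0 (okF W k P) L_gt1 g_gt0 Z_gt0)
  (edge_list_bounds M0 (okF W k P) L_gt1 g_gt0 Z_gt0).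
pose query W k P := has_cycle L (sval (Gs W k P)).
have GsP W k P : nverts (sval (Gs W k P)) = L * (2 ^ b) ^ g + M0.+2 /\
    nat_edges (sval (Gs W k P)) = edge_list L g (2 ^ b) M0 (okF W k P) by case: (Gs W k P).
have sizeG W k P : M0 < nedges (sval (Gs W k P)) <= L * window_count F + M0.+1.
  have [_ nE] := GsP W k P.
  have -> : nedges (sval (Gs W k P)) = size (nat_edges (sval (Gs W k P))) by rewrite size_map.
  by rewrite nE size_edge_list.
have queryP W k P : k <= n -> query W k P <-> exists u, feasible L g b m I W k P u.
  move=> le_k; rewrite feasibleP //; last by apply: leq_trans le_k (ltnW n_lt).
  have [_ nE] := GsP W k P; split.
    by move=> /has_cycleP[c [sz _]]; rewrite nE => cc; apply: window_of_cycle cc.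
  by move=> [u lt_u ok_u]; apply/has_cycleP; rewrite nE; apply: cycle_of_window ok_u.
have oracle W k P : k <= n -> exists w k' c, [/\ w <= h, k' <= tG F,
    halts_in w p (init (graph_input L g M0 m b I W k P)) k' c & memory c 0 = query W k P].
  move=> _; have [k' [c [le_k' hal ans]]] := p_solves (sval (Gs W k P)).
  have le_t := p_time (sizeG W k P).
  have [nV nE] := GsP W k P.
  set G := sval (Gs W k P) in le_k' hal ans le_t nV nE.
  exists (kp * (trunc_log 2 (nverts G + nedges G + t G)).+1), k', c.
  split => //; last 1 first.
  - by move: hal; rewrite digraph_input_nat nV nE.
  (* The word length of the interpreted run is governed by the size of its graph plus its time, and
     the total time [T] exceeds that sum. *)
  - apply: leq_mul; first by rewrite /k1; lia.
    rewrite ltnS; apply: leq_trunc_log; rewrite nV.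
    have /andP[_] := sizeG W k P; rewrite -/G XE => le_e.
    apply: leq_trans (_ : T <= _); last exact: leq_addl.
    move: le_e le_t; move: (nedges _) (t _) => e te le_e le_t; lia.
  - exact: leq_trans le_k' le_t.
have sz_in : size (cnf3_input F) = 2 + 3 * m by rewrite /= size_codes.
pose s0 := State (fun=> 0) I.
have sp : spec h (max3sat_cmd L g M0 p) s0 T (fun s' => forall i, i < n -> cells s' i =
    digit 2 i (fix_bits query (search_best L m query (m.+1 ^ L)).2 n)).
  apply: (spec_max3sat (I := I)) => //; rewrite -/n -/m -/b.
  - by apply: lt_h; lia.
  - by apply: lt_h; lia.
  - by apply: lt_h; lia.
  - by apply: lt_k1; rewrite /k1; lia.
  - by apply: lt_k1; rewrite /k1; lia.
  - by move=> a le_a; rewrite /I nth_default // sz_in.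
have bs : bounded h s0.
  split=> [v|a]; first by rewrite /= expn_gt0.
  have le_n : 2 * n <= T by lia.
  have le_m : m <= T by lia.
  rewrite /= /I; case: a => [|[|a]]; [by apply: lt_h; rewrite /= -/n; lia|exact: lt_h|].
  case: (ltnP a (3 * m)) => lt_a; last by rewrite nth_default ?expn_gt0 // sz_in; lia.
  by apply: lt_h; apply: leq_trans (ltnW (codes_lt lt_a)) le_n.
have [s' [k [ex le_k out]]] := sp bs.
have h_gt0 : 0 < h by apply: leq_trans le_lgh.
have [||cf' [re pc' [_ me']]] := @compile_correct h _ (ccmd 0 (max3sat_cmd L g M0 p)) _ _ _ _
  h_gt0 ex bs (init (cnf3_input F)) (wf_max3sat_cmd L g M0 p) (leqnn _).
- by exists [::], [::]; rewrite cats0.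
- by [].
exists k, cf'; split => //.
  by split => //; rewrite size_ccmd pc'.
set P := fix_bits _ _ _ in out.
exists [ffun i : 'I_n => digit 2 i P == 1]; split=> [i|a].
  rewrite me' out // ffunE; have := @digit_lt 2 i P isT; by case: (digit 2 i P) => [|[|]].
pose f v := if insub v is Some i then nat_of_bool (a i) else 0.
rewrite (@num_sat_holds F a f); last by move=> i; rewrite /f valK.
rewrite (@num_sat_holds F _ (digit 2 ^~ P)); last first.
  by move=> i; rewrite ffunE; have := @digit_lt 2 i P isT; case: (digit 2 i P) => [|[|]].
apply: (search_optimal (n := n) b_gt0 g_lt ceilL) => //.
- exact: ltnW.
- by move=> j i; apply: cnf3_lit_lt.
- by move=> v _; rewrite /f; case: insub => [i|] //; case: (a i).
Qed.

End Reduction.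

(** Only the shape matters: [L] powers of the input size come from the number of queries, one more
    from testing a label against the clauses and the prescribed values. The rest is the number of
    edges plus the time of one cycle query. *)
Lemma total_time_le L g M0 p tG : 1 < L -> exists K, forall F, total_time L g M0 p tG F <=
  K * ((nvars F + nclauses F + 1) ^ L.+1 * (L * window_count L g F + M0.+1 + tG F)).
Proof.
move=> L_gt1; pose K2 := 1100 + (6 * size p + 50) + 2 * nregs p + 560.
exists (2 * K2 + 470) => F; rewrite /total_time /query_time -/(window_count L g F).
set n := nvars F; set m := nclauses F; set X := window_count L g F; set S := n + m + 1.
set Q := L * X + M0.+1 + tG F.
have S_gt0 : 0 < S by rewrite /S addn1.
have X_gt0 : 0 < X by rewrite expn_gt0 expn_gt0.
have Q_gt0 : 0 < Q by rewrite /Q; lia.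
have LQ : L <= Q by apply: leq_trans (_ : L * X <= _); [rewrite leq_pmulr|rewrite /Q; lia].
have SQ1 : Q <= S * Q by rewrite leq_pmull.
have A1 : m.+1 ^ L + n <= 2 * S ^ L.
  have : m.+1 ^ L <= S ^ L by rewrite leq_exp2r ?(ltnW L_gt1) // /S; lia.
  have : S <= S ^ L by rewrite -{1}(expn1 S) leq_pexp2l // ltnW.
  by rewrite /S; lia.
have A2 : L * X * S * 900 + M0 * 120 + 400 +
    ((6 * size p + 50) * tG F + 2 * nregs p + 10) + 40 + 100
    <= K2 * (S * Q).
  have B1 : L * X * S <= S * Q by rewrite mulnC leq_mul2l /Q; apply/orP; right; lia.
  have B2 : M0 <= S * Q by rewrite /Q in SQ1 *; lia.
  have B3 : (6 * size p + 50) * tG F <= (6 * size p + 50) * (S * Q).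
    by rewrite leq_mul2l; apply/orP; right; rewrite /Q in SQ1 *; lia.
  have B4 : 2 * nregs p <= 2 * nregs p * (S * Q) by rewrite leq_pmulr // muln_gt0 S_gt0.
  have B5 : 0 < S * Q by rewrite muln_gt0 S_gt0.
  rewrite /K2; move: B1 B2 B3 B4 B5; move: (L * X * S) (S * Q) => u q.
  move: (6 * size p + 50) (2 * nregs p) => c d *.
  have -> : (1100 + c + d + 560) * q = 1660 * q + c * q + d * q by lia.
  lia.
have A3 : L * (m * 110 + 60) + 300 <= 470 * (S * Q).
  have C1 : L * m <= S * Q by rewrite mulnC leq_mul // /S; lia.
  have C2 : L <= S * Q by apply: leq_trans SQ1.
  have C3 : 0 < S * Q by rewrite muln_gt0 S_gt0.
  by rewrite mulnDr mulnA; lia.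
have A4 : S * Q <= S ^ L.+1 * Q.
  by rewrite leq_mul2r -{1}(expn1 S) leq_pexp2l // orbT.
rewrite [leqRHS]mulnDl.
have A5 : (m.+1 ^ L + n) * (K2 * (S * Q)) <= 2 * K2 * (S ^ L.+1 * Q).
  have -> : 2 * K2 * (S ^ L.+1 * Q) = 2 * S ^ L * (K2 * (S * Q)) by rewrite expnSr; lia.
  by rewrite leq_mul2r A1 orbT.
have A6 := leq_mul (leqnn (m.+1 ^ L + n)) A2.
have A7 : 470 * (S * Q) <= 470 * (S ^ L.+1 * Q) by rewrite leq_mul2l A4.
rewrite -(addnA (_ * _)); apply: leq_add; first exact: leq_trans A6 A5.
exact: leq_trans A3 A7.
Qed.


(** * The exponents *)

Import Order.TTheory GRing.Theory Num.Theory.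
Local Open Scope ring_scope.

Lemma ceil_third (R : realType) (L : nat) :
  Num.ceil (L%:R / 3%:R : R) = ((L + 2) %/ 3)%N.
Proof.
apply: ceil_def; set q := ((L + 2) %/ 3)%N.
have q1 : (3 * q <= L + 2)%N by rewrite /q; lia.
have q2 : (L <= 3 * q)%N by rewrite /q; lia.
rewrite ltr_pdivlMr ?ltr0n // ler_pdivrMr ?ltr0n // intrB.
have : (L%:R <= 3 * q%:R :> R) by rewrite -natrM ler_nat.
have : (3 * q%:R <= L%:R + 2 :> R) by rewrite -natrM -natrD ler_nat.
by rewrite -pmulrn; lra.
Qed.

Lemma c_expE (R : realType) (L : nat) : (3 < L)%N ->
  c_exp R L = L%:R / (L - (L + 2) %/ 3).+1%:R.
Proof.
move=> L_gt3; rewrite /c_exp ceil_third -pmulrn -natrB; last by lia.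
by rewrite -natr1.
Qed.

Theorem theorem9p4 (R : realType) (L : nat) (hL : (3 < L)%N) :
  (exists2 eps : R, 0 < eps & directed_cycle_time L (c_exp R L - eps)) ->
  exists2 eps' : R, 0 < eps' & max3sat_time (1 - eps').
Proof.
move=> [eps eps_gt0 [p [t [[kp p_solves] [C [M0 p_time]]]]]].
pose g := (L - (L + 2) %/ 3)%N.
have g_gt0 : (0 < g)%N by rewrite /g; lia.
(* For [L > 3] the ceiling of L / 3 is at least 2, so a window misses some group and [c] exceeds
   1. *)
have g_lt : (g.+1 < L)%N by rewrite /g; lia.
have ceilL : (3 * (L - g) <= L + 2)%N by rewrite /g; lia.
have cE : c_exp R L = L%:R / g.+1%:R := c_expE R hL.
set c := c_exp R L in p_time cE.
have L_gt0 : 0 < L%:R :> R by rewrite ltr0n; lia.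
have c_gt1 : 1 < c by rewrite cE ltr_pdivlMr ?ltr0n // mul1r ltr_nat.
have c_gt0 : 0 < c by apply: lt_trans c_gt1.
(* The cap keeps the exponent [e0] at least 1, so that the time linear in the number of edges spent
   on building a graph stays within the bound for the query. *)
pose eps0 := Num.min eps (c - 1).
have eps0_gt0 : 0 < eps0 by rewrite lt_min eps_gt0 subr_gt0.
pose e0 := c - eps0.
have e0_ge1 : 1 <= e0.
  by have : eps0 <= c - 1 by [rewrite ge_min lexx orbT]; rewrite /e0; lra.
have le_e0 : c - eps <= e0.
  by have : eps0 <= eps by [rewrite ge_min lexx]; rewrite /e0; lra.
have e0_ge0 : 0 <= e0 by apply: le_trans e0_ge1.
pose Mx (F : cnf3) := (L * window_count L g F + M0.+1)%N.
(* One time bound for all query graphs of [F], none of which has more than [Mx F] edges. The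
   absolute value makes the bound monotone whatever the sign of [C]; truncation loses nothing, as
   times are natural numbers. *)
pose tG F := Num.truncn (`|C| * (Mx F)%:R `^ e0).
have tG_ok F G : (M0 < nedges G <= L * window_count L g F + M0.+1)%N -> (t G <= tG F)%N.
  move=> /andP[lt_M le_M]; rewrite truncn_ge_nat ?mulr_ge0 ?powR_ge0 //.
  apply: le_trans (p_time G (ltnW lt_M)) _.
  have M1 : 1 <= (nedges G)%:R :> R by rewrite ler1n; lia.
  apply: le_trans (ler_wpM2r (powR_ge0 _ _) (ler_norm C)) _.
  apply: ler_wpM2l => //; apply: le_trans (ler_powR M1 le_e0) _.
  by apply: ge0_ler_powR => //; rewrite ?nnegrE ?ler0n // ler_nat.
have L_gt1 : (1 < L)%N by lia.
have red := reduction_solves L_gt1 g_gt0 (ltnW g_lt) ceilL p_solves tG_ok.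
have [K le_K] := total_time_le g M0 p tG L_gt1.
exists (eps0 / c); first exact: divr_gt0.
eexists; eexists; split; first exact: red.
(* [2 ^+ g.+1] pays for the extra variable in each of the [g.+1] groups of a window, [L + M0.+1] for
   the layers and the star. *)
pose K4 : R := (L + M0.+1)%:R * 2 ^+ g.+1.
exists (K%:R * ((1 + `|C|) * K4 `^ e0)), L.+1 => F.
set n := nvars F; set S := (n + nclauses F + 1)%N.
have X_le : (window_count L g F)%:R <= 2 ^+ g.+1 * 2 `^ (n%:R / c) :> R.
  rewrite /window_count -expnM natrX -powR_mulrn // -powR_mulrn // -powRD; last first.
    by rewrite pnatr_eq0 implybT.
  apply: ler_powR; first by rewrite ler1n.
  rewrite natrM /group_size natrD mulrDl mul1r addrC lerD2l cE invf_div mulrA mulrAC.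
  apply: ler_wpM2r; first by rewrite ler0n.
  by rewrite ler_pdivlMr // -natrM ler_nat leq_divM.
have M1 : 1 <= (Mx F)%:R :> R by rewrite ler1n /Mx; lia.
have M_le : (Mx F)%:R <= K4 * 2 `^ (n%:R / c).
  apply: le_trans (_ : (L + M0.+1)%:R * (window_count L g F)%:R <= _); last first.
    by rewrite /K4 -mulrA; apply: ler_wpM2l.
  rewrite -natrM ler_nat /Mx mulnDl leq_add2l leq_pmulr // /window_count.
  by rewrite expn_gt0 expn_gt0.
have MxE : (Mx F)%:R `^ e0 <= K4 `^ e0 * 2 `^ ((1 - eps0 / c) * n%:R).
  have -> : (1 - eps0 / c) * n%:R = n%:R / c * e0 by rewrite /e0; field; rewrite gt_eqF.
  have K4_ge0 : 0 <= K4 by rewrite mulr_ge0 ?exprn_ge0.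
  rewrite powRrM -powRM ?powR_ge0 //.
  by apply: ge0_ler_powR; rewrite ?nnegrE ?ler0n // mulr_ge0 ?powR_ge0.
(* Here [e0 >= 1] is used: the number of edges is at most its own power. *)
have Q_le : (Mx F + tG F)%:R <= (1 + `|C|) * (Mx F)%:R `^ e0.
  rewrite natrD mulrDl mul1r lerD // ?le1r_powR //.
  by rewrite truncn_le mulr_ge0 ?powR_ge0.
apply: le_trans (_ : (K * (S ^ L.+1 * (Mx F + tG F)))%:R <= _).
  by rewrite ler_nat; apply: le_K.
rewrite !natrM natrX -!mulrA ler_wpM2l //.
rewrite mulrCA [leRHS]mulrA [leRHS]mulrCA ler_wpM2l ?exprn_ge0 //.
by apply: le_trans Q_le _; rewrite [K4 `^ e0 * _]mulrC -mulrA ler_wpM2l ?addr_ge0.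
Qed.
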